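(* Assume $\mathbf U\in\mathcal G_\gamma$. Then: (i) (Scaling invariance) $\lambda\mathbf U\in\mathcal G_\gamma$ for every $\lambda>0$. (ii) (Lax-Friedrichs splitting) For every vector $\boldsymbol\xi=(\xi_1,\xi_2,\xi_3)\ne\mathbf 0$, $$\mathbf U\pm\varrho_\xi^{-1}\,\xi_j\mathbf F^j(\mathbf U)\in\overline{\mathcal G}_\gamma,$$ and $$\mathbf U\pm\eta^{-1}\,\xi_j\mathbf F^j(\mathbf U)\in\mathcal G_\gamma\qquad\text{for every }\eta>\varrho_\xi,$$ where $\varrho_\xi$ is an upper bound of the spectral radius of the Jacobian matrix $\partial(\xi_j\mathbf F^j(\mathbf U))/\partial\mathbf U$ which can be taken as follows: for a general equation of state, $$\varrho_\xi=\sqrt{\xi_j\xi^j}+\frac{|\xi_j\beta^j|}{\alpha};$$ for the ideal equation of state, also the smaller value $$\varrho_\xi=\frac{1}{1-v^2c_s^2}\Big\{|\xi_jv^j|(1-c_s^2)+c_s w^{-1}\sqrt{(1-v^2c_s^2)(\xi_j\xi^j)-(1-c_s^2)(\xi_jv^j)^2}\Big\}+\frac{|\xi_j\beta^j|}{\alpha}.$$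
   Context: Latin indices run from 1 to 3; repeated indices are summed. At a fixed spacetime point let $\alpha>0$ (lapse), $\beta^i$ (shift), and $(\gamma_{ij})$ a symmetric positive definite 3-metric with inverse $\boldsymbol\Upsilon=(\gamma^{ij})$; indices are raised/lowered with them (e.g. $\xi^j=\gamma^{jk}\xi_k$, $v^j=\gamma^{jk}v_k$). Equation of state (EOS): $e(p,\rho)$ is $C^1$ on $(0,\infty)^2$, $h(p,\rho)=1+e+p/\rho$, and for all $p,\rho>0$: $h\ge\sqrt{1+p^2/\rho^2}+p/\rho$; $h(\frac1\rho-\partial_ph)<\partial_\rho h<0$; $\lim_{p\to0^+}e(p,\rho)=0$, $\lim_{p\to+\infty}e(p,\rho)=+\infty$. The ideal EOS is $h=1+\frac{\Gamma p}{(\Gamma-1)\rho}$ with $\Gamma\in(1,2]$. The sound speed is $c_s^2=h^{-1}\,\partial_\rho h\,/\,(\frac1\rho-\partial_ph)$, so $0<c_s<1$ (and $c_s^2=\Gamma p/(\rho h)$ for the ideal EOS). Admissible set: $\mathcal G_\gamma=\{\mathbf U=(D,\mathbf m,E)^\top\in\mathbb R^5: D>0,\ E-\sqrt{D^2+\mathbf m\boldsymbol\Upsilon\mathbf m^\top}>0\}$, with closure $\overline{\mathcal G}_\gamma$. Each $\mathbf U\in\mathcal G_\gamma$ corresponds to exactly one set of primitive variables $(\rho,\mathbf v,p)$, $\mathbf v=(v_1,v_2,v_3)$, with $\rho>0$, $p>0$, $v:=\sqrt{v_jv^j}<1$ (and then $e>0$), via $D=\rho w$, $\mathbf m=\rho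 hw^2\mathbf v$, $E=\rho hw^2-p$, where $w=(1-v^2)^{-1/2}$; conversely all such primitive variables give $\mathbf U\in\mathcal G_\gamma$. Fluxes: with $\tilde v^i=v^i-\beta^i/\alpha$ and $\mathbf e_i$ the $i$-th row of the $3\times3$ identity matrix, $$\mathbf F^i(\mathbf U)=\big(D\tilde v^i,\ \tilde v^i\mathbf m+p\,\mathbf e_i,\ E\tilde v^i+pv^i\big)^\top.$$ The eigenvalues of $\partial(\xi_j\mathbf F^j)/\partial\mathbf U$ are known to be $\xi_jv^j-\xi_j\beta^j/\alpha$ (three times) and $\frac{1}{1-v^2c_s^2}\{\xi_jv^j(1-c_s^2)\pm c_sw^{-1}\sqrt{(1-v^2c_s^2)(\xi_j\xi^j)-(1-c_s^2)(\xi_jv^j)^2}\}-\xi_j\beta^j/\alpha$. *)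

(* Defs.v *)
From HB Require Import structures.
From mathcomp Require Import all_boot all_order all_algebra.
From mathcomp Require Import all_classical all_reals all_analysis.
From mathcomp Require Import complex.

Set Implicit Arguments.
Unset Strict Implicit.
Unset Printing Implicit Defensive.

Import Order.TTheory GRing.Theory Num.Theory.
Import numFieldNormedType.Exports.

Local Open Scope classical_set_scope.
Local Open Scope ring_scope.

(* Covectors (v_i, m_i, xi_i) and vectors (beta^i) are both rows of length 3;
   gam is the matrix (gamma_ij) and invmx gam is (gamma^ij). *)

Definition is_metric (R : realType) (gam : 'M[R]_3) : Prop :=
  gam^T = gam /\ forall x : 'rV[R]_3, x != 0 -> 0 < (x *m gam *m x^T) 0 0.

(* a_j b^j for covectors a, b *)
Definition codot (R : realType) (gam : 'M[R]_3) (a b : 'rV[R]_3) : R :=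
  (a *m invmx gam *m b^T) 0 0.

(* v^i *)
Definition raise (R : realType) (gam : 'M[R]_3) (v : 'rV[R]_3) : 'rV[R]_3 :=
  v *m invmx gam.

(* a_j b^j for a covector a and a vector b *)
Definition pairing (R : realType) (a b : 'rV[R]_3) : R :=
  \sum_(j < 3) a 0 j * b 0 j.

(* e p rho, with the pressure first *)
Definition enthalpy (R : realType) (e : R -> R -> R) (p rho : R) : R :=
  1 + e p rho + p / rho.

Definition dp (R : realType) (f : R -> R -> R) (p rho : R) : R :=
  derive1 (fun q : R => f q rho) p.

Definition drho (R : realType) (f : R -> R -> R) (p rho : R) : R :=
  derive1 (fun r : R => f p r) rho.

Definition C1_quadrant (R : realType) (f : R -> R -> R) : Prop :=
  forall p rho : R, 0 < p -> 0 < rho ->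
    [/\ derivable (fun q : R => f q rho) p 1,
        derivable (fun r : R => f p r) rho 1,
        {for (p, rho), continuous (fun z : R * R => dp f z.1 z.2)} &
        {for (p, rho), continuous (fun z : R * R => drho f z.1 z.2)}].

Record is_eos (R : realType) (e : R -> R -> R) : Prop := IsEos {
  eos_C1 : C1_quadrant e ;
  eos_enthalpy_ge : forall p rho : R, 0 < p -> 0 < rho ->
    Num.sqrt (1 + p ^+ 2 / rho ^+ 2) + p / rho <= enthalpy e p rho ;
  eos_drho_gt : forall p rho : R, 0 < p -> 0 < rho ->
    enthalpy e p rho * (rho^-1 - dp (enthalpy e) p rho)
      < drho (enthalpy e) p rho ;
  eos_drho_lt0 : forall p rho : R, 0 < p -> 0 < rho ->
    drho (enthalpy e) p rho < 0 ;
  eos_lim0 : forall rho : R, 0 < rho -> e p rho @[p --> 0^'+] --> (0 : R) ;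
  eos_limy : forall rho : R, 0 < rho -> e p rho @[p --> +oo%R] --> +oo%R
}.

Definition is_ideal_eos (R : realType) (Gam : R) (e : R -> R -> R) : Prop :=
  forall p rho : R, 0 < p -> 0 < rho ->
    enthalpy e p rho = 1 + Gam * p / ((Gam - 1) * rho).

Definition sound_speed (R : realType) (e : R -> R -> R) (p rho : R) : R :=
  Num.sqrt ((enthalpy e p rho)^-1 * drho (enthalpy e) p rho
            / (rho^-1 - dp (enthalpy e) p rho)).

(* U = (D, m, E) *)
Notation state R := 'rV[R]_(1 + (3 + 1)).

Definition mkstate (R : realType) (D : R) (m : 'rV[R]_3) (E : R)
    : state R :=
  row_mx D%:M (row_mx m E%:M).

Definition sD (R : realType) (U : state R) : R := lsubmx U 0 0.
Definition sm (R : realType) (U : state R) : 'rV[R]_3 :=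
  lsubmx (rsubmx U).
Definition sE (R : realType) (U : state R) : R :=
  rsubmx (rsubmx U) 0 0.

Definition admissible (R : realType) (gam : 'M[R]_3)
    : set (state R) :=
  [set U | 0 < sD U
         /\ 0 < sE U - Num.sqrt (sD U ^+ 2 + codot gam (sm U) (sm U))].

Definition speed (R : realType) (gam : 'M[R]_3) (v : 'rV[R]_3) : R :=
  Num.sqrt (codot gam v v).

Definition lorentz (R : realType) (gam : 'M[R]_3) (v : 'rV[R]_3) : R :=
  (Num.sqrt (1 - speed gam v ^+ 2))^-1.

(* Primitive variables are triples (rho, v, p). *)
Definition is_prim (R : realType) (gam : 'M[R]_3)
    (W : R * 'rV[R]_3 * R) : Prop :=
  let: (rho, v, p) := W in [/\ 0 < rho, 0 < p & speed gam v < 1].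

Definition conservative (R : realType) (e : R -> R -> R) (gam : 'M[R]_3)
    (W : R * 'rV[R]_3 * R) : state R :=
  let: (rho, v, p) := W in
  let h := enthalpy e p rho in
  let w := lorentz gam v in
  mkstate (rho * w) ((rho * h * w ^+ 2) *: v) (rho * h * w ^+ 2 - p).

(* The primitive variables of U; they exist and are unique for U admissible
   and e satisfying is_eos. *)
Definition primitive (R : realType) (e : R -> R -> R) (gam : 'M[R]_3)
    (U : state R) : R * 'rV[R]_3 * R :=
  get [set W | is_prim gam W /\ conservative e gam W = U].

Definition flux (R : realType) (e : R -> R -> R) (alpha : R)
    (beta : 'rV[R]_3) (gam : 'M[R]_3) (i : 'I_3)
    (U : state R) : state R :=
  let: (rho, v, p) := primitive e gam U in
  let vi := raise gam v 0 i in
  let tvi := vi - beta 0 i / alpha in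
  mkstate (sD U * tvi) (tvi *: sm U + p *: delta_mx 0 i) (sE U * tvi + p * vi).

(* xi_j F^j(U) *)
Definition dir_flux (R : realType) (e : R -> R -> R) (alpha : R)
    (beta : 'rV[R]_3) (gam : 'M[R]_3) (xi : 'rV[R]_3)
    (U : state R) : state R :=
  \sum_(j < 3) xi 0 j *: flux e alpha beta gam j U.

(* The largest modulus of the complex eigenvalues of a real matrix. *)
Definition spectral_radius (R : realType) (n : nat) (A : 'M[R]_n) : R :=
  sup [set complex.ComplexField.Normc.normc z | z in
         [set z : complex R |
            eigenvalue (map_mx (fun x : R => Complex x 0) A) z]].

Definition rho_general (R : realType) (alpha : R) (beta : 'rV[R]_3)
    (gam : 'M[R]_3) (xi : 'rV[R]_3) : R :=
  Num.sqrt (codot gam xi xi) + `|pairing xi beta| / alpha.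

Definition rho_ideal (R : realType) (e : R -> R -> R) (alpha : R)
    (beta : 'rV[R]_3) (gam : 'M[R]_3) (xi : 'rV[R]_3)
    (U : state R) : R :=
  let: (rho, v, p) := primitive e gam U in
  let cs := sound_speed e p rho in
  let v2 := speed gam v ^+ 2 in
  let xiv := codot gam xi v in
  (1 - v2 * cs ^+ 2)^-1
    * (`|xiv| * (1 - cs ^+ 2)
       + cs * (lorentz gam v)^-1
         * Num.sqrt ((1 - v2 * cs ^+ 2) * codot gam xi xi
                     - (1 - cs ^+ 2) * xiv ^+ 2))
  + `|pairing xi beta| / alpha.

(* r bounds the spectral radius of d(xi_j F^j)/dU at U, and the Lax-Friedrichs
   splitting of U in direction xi holds with r. The library's Jacobian acts on
   rows, so it is the transpose of the usual one, with the same eigenvalues;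
   it is a genuine derivative, since the flux is differentiable at admissible
   states. *)
Definition LF_splitting (R : realType) (e : R -> R -> R) (alpha : R)
    (beta : 'rV[R]_3) (gam : 'M[R]_3) (xi : 'rV[R]_3)
    (U : state R) (r : R) : Prop :=
  let F := dir_flux e alpha beta gam xi in
  [/\ spectral_radius (jacobian F U) <= r,
      closure (admissible gam) (U + r^-1 *: F U),
      closure (admissible gam) (U - r^-1 *: F U) &
      forall eta : R, r < eta ->
        admissible gam (U + eta^-1 *: F U)
        /\ admissible gam (U - eta^-1 *: F U)].

(* Main.v *)
(* The primitive variables are determined by the pressure alone, which is the
   root of a scalar function that increases wherever it is nonpositive; hence
   they exist and are unique.

   Spectral radius: [F] composed with [conservative] is an explicit function
   of the primitive variables, so differentiating along curves of primitive
   variables gives [MU J = MG - b MU] for the Jacobian [J], with explicit [MU]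
   and [MG] and [b = xi_j beta^j / alpha].  An eigenvalue [mu - b] makes
   [MG - mu MU] singular, and solving [Y (MG - mu MU) = 0] leaves for [mu] only
   the material speed and the two roots of the acoustic quadratic.  If [F] were
   not differentiable, [jacobian] would be the junk value [0], whose spectral
   radius is [0].

   Splitting: writing [F = G - b U], [U + t F] is a positive multiple of
   [U + t' G], with [t'] smaller than the inverse of the speed bound relative
   to [beta].  For [U + G] in direction [zeta], with [a = 1 + zeta_j v^j],
     [E'^2 - D'^2 - |m'|^2
      = a^2 w^2 (rho^2 h^2 - rho^2 - 2 p rho h) + p^2 (1 - |zeta|^2)],
   whose first term is nonnegative by the enthalpy bound and, for the ideal
   equation of state, dominates the second when [|zeta| > 1]. *)

Require Import Defs.
From HB Require Import structures.
From mathcomp Require Import all_boot all_order all_algebra.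
From mathcomp Require Import all_classical all_reals all_analysis.
From mathcomp Require Import complex ring lra.
Set Implicit Arguments.
Unset Strict Implicit.
Unset Printing Implicit Defensive.
Import Order.TTheory GRing.Theory Num.Theory.
Import numFieldNormedType.Exports.
Local Open Scope classical_set_scope.
Local Open Scope ring_scope.

(** * Derivatives along curves and the equation of state *)

(** The endpoints are allowed in either order because the lemma is applied between [g p] and [g q]
    along a curve [g], where the sign of the increment is unknown. *)
Lemma mean_value_rho (R : realType) (f : R -> R -> R) (q a b : R) :
  (forall r, 0 < r -> derivable (f q) r 1) -> 0 < a -> 0 < b -> a != b ->
  exists2 r : R, Num.min a b < r < Num.max a b &
    f q b - f q a = drho f q r * (b - a).
Proof.
move=> fd; wlog ab : a b / a < b.
  move=> H a0 b0 ab; have /orP[ab'|ba] : (a < b) || (b < a) by rewrite -neq_lt.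
    exact: H.
  have [|r rab E] := H _ _ ba b0 a0; first by rewrite eq_sym.
  exists r; first by rewrite minC maxC.
  by rewrite -opprB E -mulrN opprB.
move=> a0 b0 _.
have der x : a <= x -> is_derive x 1 (f q) (drho f q x).
  by move=> ax; rewrite /drho derive1E; apply/derivableP/fd/(lt_le_trans a0).
have [||r rab E] := @MVT R (f q) (drho f q) a b ab.
- by move=> x; rewrite in_itv /= => /andP[/ltW ax _]; exact: der.
- apply: derivable_within_continuous => x; rewrite in_itv /= => /andP[ax _].
  exact: (@ex_derive _ _ _ _ _ _ _ (der x ax)).
exists r => //.
by move: rab; rewrite in_itv /= (min_idPl (ltW ab)) (max_idPr (ltW ab)).
Qed.

(** The increment of [f] along the curve splits into a change of the second argument at fixed [q]
    and a change of the first argument at fixed [g p]. By the mean value theorem the former is a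
    value of [drho f] near [(p, g p)] times the increment of [g], and joint continuity of [drho f]
    gives its limit. *)
Lemma is_derive_quadrant (R : realType) (f : R -> R -> R) (g : R -> R)
    (p dg : R) :
  C1_quadrant f -> 0 < p -> 0 < g p -> is_derive p 1 g dg ->
  is_derive p 1 (fun q => f q (g q))
    (dp f p (g p) + drho f p (g p) * dg).
Proof.
move=> fC p0 gp0 gd; have [dfp _ _ crho] := fC _ _ p0 gp0.
have cg : {for p, continuous g}.
  by apply/differentiable_continuous/derivable1_diffP; exact: ex_derive.
(* The secant slope in the second argument, completed by its limit where [g q = g p], so that the
   factorization [fE] holds for every [q]. *)
pose k q := if g q == g p then drho f p (g p)
  else (f q (g q) - f q (g p)) / (g q - g p).
have fE q : f q (g q) = f q (g p) + k q * (g q - g p).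
  rewrite /k; case: eqVneq => [->|gqp]; first by rewrite subrr mulr0 addr0.
  by rewrite mulfVK ?subr_eq0 // addrC subrK.
have ck : k q @[q --> p] --> drho f p (g p).
  apply/cvgrPdist_lt => eps eps0.
  move/cvgrPdist_lt : crho => /(_ _ eps0) [[/= A B] [/= Ap Bg] AB].
  have /nbhs_ballP[d /= d0 dB] := Bg.
  near=> q.
  have q0 : 0 < q by near: q; exact: lt_nbhsr.
  have gq0 : 0 < g q by near: q; exact: (cvgr_gt (g p)).
  rewrite /k; case: eqVneq => [_|gqp]; first by rewrite subrr normr0.
  have [||r /andP[r1 r2] ->] := @mean_value_rho R f q (g p) (g q) _ gp0 gq0.
  - by move=> r r0; case: (fC q r q0 r0) => _ dr _ _; exact: dr.
  - by rewrite eq_sym.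
  rewrite mulfK ?subr_eq0 //.
  apply: (AB (q, r)); split => /=; first by near: q.
  apply: dB; rewrite /ball /=.
  have : `|g p - g q| < d by near: q; move: (d) d0; apply/cvgrPdist_lt.
  move: r1 r2; rewrite gt_min lt_max.
  by case: (ltgtP (g p) (g q)) gqp => [gpq|gpq|->]; rewrite ?eqxx // => _;
    rewrite ?ltr_norml ?ltr_distl; lra.
have -> : (fun q => f q (g q)) = (fun q => f q (g p) + k q * (g q - g p)).
  by apply/funext.
suff H : (fun h => h^-1 *: (f (h + p) (g p) - f p (g p)) +
   k (h + p) * (h^-1 *: (g (h + p) - g p))) @ 0^' -->
   dp f p (g p) + drho f p (g p) * dg.
  have H' : (fun h : R => h^-1 *: (((fun q => f q (g p) + k q * (g q - g p))
    \o shift p) (h *: 1) - (f p (g p) + k p * (g p - g p)))) @ 0^' -->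
   dp f p (g p) + drho f p (g p) * dg.
    apply: cvg_trans H; apply: near_eq_cvg; near=> h => /=.
    rewrite /GRing.scale /= subrr mulr0 addr0 mulr1; ring.
  split; first by apply/cvg_ex; eexists; exact: H'.
  exact/cvg_lim.
apply: cvgD; last apply: cvgM.
- rewrite /dp derive1E.
  have := dfp; rewrite /derivable /derive => /cvg_ex[l hl].
  rewrite (cvg_lim _ hl) //; apply: cvg_trans hl; apply: near_eq_cvg.
  by near=> h => /=; rewrite /GRing.scale /= mulr1.
- have : h + p @[h --> 0^'] --> p.
    apply: cvg_within_filter; rewrite -{2}[p]add0r.
    by apply: cvgD; [exact: cvg_id|exact: cvg_cst].
  by move=> /cvg_comp; apply.
- case: gd => [gd gv]; move: gd gv; rewrite /derivable /derive => /cvg_ex[l hl].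
  rewrite (cvg_lim _ hl) // => <-; apply: cvg_trans hl; apply: near_eq_cvg.
  by near=> h => /=; rewrite /GRing.scale /= mulr1.
Unshelve. all: by end_near. Qed.

Lemma is_derive1V (R : realType) (f : R -> R) (x df : R) :
  is_derive x 1 f df -> f x != 0 -> is_derive x 1 (fun t => (f t)^-1)
    (- (f x) ^- 2 * df).
Proof.
move=> [d v] fx0; split; first exact: derivableV.
by rewrite deriveV // v.
Qed.

Lemma is_derive1_div (R : realType) (f g : R -> R) (x df dg : R) :
  is_derive x 1 f df -> is_derive x 1 g dg -> g x != 0 ->
  is_derive x 1 (fun t => f t / g t) ((df * g x - f x * dg) / g x ^+ 2).
Proof.
move=> fd gd gx0; have gVd := is_derive1V gd gx0.
apply: is_derive_eq; rewrite /GRing.scale /=; by field.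
Qed.

Lemma is_derive1_mul (R : realType) (f g : R -> R) (x df dg : R) :
  is_derive x 1 f df -> is_derive x 1 g dg ->
  is_derive x 1 (fun t => f t * g t) (df * g x + f x * dg).
Proof.
move=> fd gd; have H : is_derive x 1 (f * g) (f x *: dg + g x *: df).
  exact: is_deriveM.
apply: is_derive_eq; rewrite /GRing.scale /=; ring.
Qed.

Lemma is_derive1_sqr (R : realType) (f : R -> R) (x df : R) :
  is_derive x 1 f df -> is_derive x 1 (fun t => f t ^+ 2) (2 * f x * df).
Proof.
move=> fd; apply: is_derive_eq (is_derive1_mul fd fd) _; ring.
Qed.

Lemma is_derive1_sqrt_comp (R : realType) (f : R -> R) (x df : R) :
  is_derive x 1 f df -> 0 < f x ->
  is_derive x 1 (fun t => Num.sqrt (f t)) (df / (2 * Num.sqrt (f x))).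
Proof.
move=> fd fx0; have sd := is_derive1_sqrt fx0.
by rewrite mulrC; exact: (@is_derive1_comp _ Num.sqrt).
Qed.

Lemma is_derive1_affine (R : realType) (x y t : R) :
  is_derive t 1 (fun s => x + s * y) y.
Proof. by apply: is_derive_eq; rewrite /GRing.scale /=; ring. Qed.

Section EquationOfState.
Variables (R : realType) (e : R -> R -> R).
Hypothesis eP : is_eos e.
Local Notation h := (enthalpy e).

Lemma is_derive_enthalpy_p (p rho : R) : 0 < p -> 0 < rho ->
  is_derive p 1 (fun q => h q rho) (dp e p rho + rho^-1).
Proof.
move=> p0 r0; have [d _ _ _] := eos_C1 eP p0 r0.
have d1 : is_derive p 1 (fun q => e q rho) (dp e p rho).
  by rewrite /dp derive1E; exact: derivableP.
rewrite /enthalpy; apply: is_derive_eq.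
rewrite /GRing.scale /=; ring.
Qed.

Lemma is_derive_enthalpy_rho (p rho : R) : 0 < p -> 0 < rho ->
  is_derive rho 1 (h p) (drho e p rho - p / rho ^+ 2).
Proof.
move=> p0 r0; have [_ d _ _] := eos_C1 eP p0 r0.
have d1 : is_derive rho 1 (e p) (drho e p rho).
  by rewrite /drho derive1E; exact: derivableP.
have d2 := is_derive1_div (is_derive_cst p rho 1)
  (is_derive_id rho 1) (lt0r_neq0 r0).
rewrite /enthalpy; apply: is_derive_eq.
by rewrite /=; field; apply: lt0r_neq0.
Qed.

Lemma dp_enthalpy (p rho : R) : 0 < p -> 0 < rho ->
  dp h p rho = dp e p rho + rho^-1.
Proof.
move=> p0 r0; rewrite {1}/dp derive1E.
exact: (derive_val (is_derive := is_derive_enthalpy_p p0 r0)).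
Qed.

Lemma drho_enthalpy (p rho : R) : 0 < p -> 0 < rho ->
  drho h p rho = drho e p rho - p / rho ^+ 2.
Proof.
move=> p0 r0; rewrite {1}/drho derive1E.
exact: (derive_val (is_derive := is_derive_enthalpy_rho p0 r0)).
Qed.

Lemma is_derive_enthalpy (g : R -> R) (p dg : R) :
  0 < p -> 0 < g p -> is_derive p 1 g dg ->
  is_derive p 1 (fun q => h q (g q)) (dp h p (g p) + drho h p (g p) * dg).
Proof.
move=> p0 gp0 gd; have ed := is_derive_quadrant (eos_C1 eP) p0 gp0 gd.
have d2 := is_derive1_div (is_derive_id p 1) gd (lt0r_neq0 gp0).
rewrite /enthalpy; apply: is_derive_eq.
rewrite dp_enthalpy // drho_enthalpy //; field; exact: lt0r_neq0.
Qed.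

Lemma enthalpy_decr (p a b : R) : 0 < p -> 0 < a -> a <= b -> h p b <= h p a.
Proof.
move=> p0 a0; rewrite le_eqVlt => /predU1P[->//|ab].
have b0 := lt_trans a0 ab.
have [||r] := @mean_value_rho _ h p a b _ a0 b0.
- by move=> r r0; exact: (ex_derive (is_derive := is_derive_enthalpy_rho p0 r0)).
- by rewrite lt_eqF.
rewrite (min_idPl (ltW ab)) => /andP[ar _] E.
rewrite -subr_le0 E mulr_le0_ge0 ?subr_ge0 ?ltW //.
by apply: eos_drho_lt0 => //; exact: lt_trans ar.
Qed.

Variables p rho : R.
Hypotheses (p0 : 0 < p) (r0 : 0 < rho).

Lemma enthalpy_gt0 : 0 < h p rho.
Proof.
apply: lt_le_trans (eos_enthalpy_ge eP p0 r0).
by rewrite ltr_wpDl ?sqrtr_ge0 ?divr_gt0.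
Qed.

(** Moving [p / rho] to the other side of the enthalpy bound and squaring makes the terms in [p^2]
    cancel. What remains is the sign of the coefficient of [a^2 w^2] in the identity for the split
    states. *)
Lemma enthalpy_sqr : 2 * p * rho * h p rho + rho ^+ 2 <= rho ^+ 2 * h p rho ^+ 2.
Proof.
have := eos_enthalpy_ge eP p0 r0; set H := h p rho.
rewrite -lerBrDr => sH.
have H0 := le_trans (sqrtr_ge0 _) sH.
have : Num.sqrt (1 + p ^+ 2 / rho ^+ 2) ^+ 2 <= (H - p / rho) ^+ 2.
  by rewrite ler_sqr ?nnegrE ?sqrtr_ge0.
rewrite sqr_sqrtr; last by rewrite addr_ge0 ?divr_ge0 ?sqr_ge0.
rewrite -(ler_pM2r (exprn_gt0 2 r0)).
have -> : (1 + p ^+ 2 / rho ^+ 2) * rho ^+ 2 = rho ^+ 2 + p ^+ 2.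
  by field; exact: lt0r_neq0.
have -> : (H - p / rho) ^+ 2 * rho ^+ 2 = rho ^+ 2 * H ^+ 2 - 2 * p * rho * H + p ^+ 2.
  by field; exact: lt0r_neq0.
lra.
Qed.

(** The root in the enthalpy bound strictly exceeds [p / rho]. This keeps the energy [rho h w^2 - p]
    away from zero. *)
Lemma enthalpy_gt_2p : 2 * p < rho * h p rho.
Proof.
rewrite mulrC [ltRHS]mulrC -ltr_pdivrMr //.
apply: lt_le_trans (eos_enthalpy_ge eP p0 r0).
have pr0 : 0 <= p / rho by rewrite divr_ge0 ?ltW.
suff : p / rho < Num.sqrt (1 + p ^+ 2 / rho ^+ 2) by rewrite mulrAC; lra.
have pos : 0 < 1 + p ^+ 2 / rho ^+ 2.
  by rewrite ltr_pwDl ?divr_ge0 ?sqr_ge0.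
rewrite -{1}(ger0_norm pr0) -sqrtr_sqr ltr_sqrt // exprMn exprVn.
by rewrite ltrDr.
Qed.

End EquationOfState.

(** * Recovery of the primitive variables *)

Section SoundSpeed.
Variables (R : realType) (e : R -> R -> R) (p rho : R).
Hypotheses (eP : is_eos e) (p0 : 0 < p) (r0 : 0 < rho).
Local Notation h := (enthalpy e).
Local Notation cs := (sound_speed e p rho).

(** Chaining the two bounds on [drho h] makes the product with [h > 0] negative. Numerator and
    denominator of the squared sound speed are thus both negative, and the root in [sound_speed] is
    taken of a positive number. *)
Lemma dp_enthalpy_gtVrho : rho^-1 - dp h p rho < 0.
Proof.
have := lt_trans (eos_drho_gt eP p0 r0) (eos_drho_lt0 eP p0 r0).
by rewrite pmulr_rlt0 // enthalpy_gt0.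
Qed.

Lemma sound_speed_sqr_bounds : 0 < cs /\ cs ^+ 2 < 1.
Proof.
have h0 := enthalpy_gt0 eP p0 r0.
have a0 := dp_enthalpy_gtVrho; have hr0 := eos_drho_lt0 eP p0 r0.
have c0 : 0 < (h p rho)^-1 * drho h p rho / (rho^-1 - dp h p rho).
  by rewrite -mulrA pmulr_rgt0 ?invr_gt0 // nmulr_lgt0 ?invr_lt0.
split; first by rewrite sqrtr_gt0.
rewrite sqr_sqrtr ?ltW // -mulrA mulrC ltr_pdivrMr // mul1r.
by rewrite ltr_ndivrMr // mulrC mulrC eos_drho_gt.
Qed.

Lemma drho_enthalpyE :
  drho h p rho = cs ^+ 2 * h p rho * (rho^-1 - dp h p rho).
Proof.
have h0 := enthalpy_gt0 eP p0 r0.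
have a0 := dp_enthalpy_gtVrho; have hr0 := eos_drho_lt0 eP p0 r0.
rewrite sqr_sqrtr.
  move: (rho^-1 - _) a0 => a a0.
  by field; rewrite (lt_eqF a0) gt_eqF.
by rewrite -mulrA mulr_ge0 ?invr_ge0 ?ltW // nmulr_lgt0 ?invr_lt0.
Qed.

End SoundSpeed.

Section Recovery.
Variables (R : realType) (e : R -> R -> R) (D E m2 : R).
Hypotheses (eP : is_eos e) (D0 : 0 < D) (m20 : 0 <= m2).
Local Notation h := (enthalpy e).

(* Given [D], [E] and [m2 = |m|^2], the pressure [p] determines
   [v = m / (E + p)] and [rho = D / w]; the remaining equation
   [E + p = rho h w^2] reads [pressure_eq p = 0]. *)
Definition rho_of (p : R) : R := D * Num.sqrt ((E + p) ^+ 2 - m2) / (E + p).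

Definition pressure_eq (p : R) : R :=
  h p (rho_of p) - Num.sqrt ((E + p) ^+ 2 - m2) / D.

Section At.
Variable p : R.
Hypotheses (p0 : 0 < p) (s0 : 0 < E + p) (ms : m2 < (E + p) ^+ 2).
Local Notation s := (E + p).
Local Notation r := (Num.sqrt (s ^+ 2 - m2)).

Let r0 : 0 < r. Proof. by rewrite sqrtr_gt0 subr_gt0. Qed.

Lemma rho_of_gt0 : 0 < rho_of p.
Proof. by rewrite divr_gt0 ?mulr_gt0. Qed.

Lemma is_derive_pressure_eq : is_derive p 1 pressure_eq
  (dp h p (rho_of p) - (rho_of p)^-1
   + drho h p (rho_of p) * (D * m2 / (r * s ^+ 2))).
Proof.
have sN := lt0r_neq0 s0; have rN := lt0r_neq0 r0; have DN := lt0r_neq0 D0.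
have r2 : r ^+ 2 = s ^+ 2 - m2 by rewrite sqr_sqrtr // ltW // subr_gt0.
have sd : is_derive p 1 (fun q => E + q) 1.
  by apply: is_derive_eq; ring.
have qd : is_derive p 1 (fun q => (E + q) ^+ 2 - m2) (2 * s).
  have sqd := is_derive1_sqr sd; apply: is_derive_eq.
  by rewrite /GRing.scale /=; ring.
have rd : is_derive p 1 (fun q => Num.sqrt ((E + q) ^+ 2 - m2)) (s / r).
  have pos : 0 < s ^+ 2 - m2 by rewrite subr_gt0.
  by apply: is_derive_eq (is_derive1_sqrt_comp qd pos) _; field.
have rhod : is_derive p 1 rho_of (D * m2 / (r * s ^+ 2)).
  have Drd := is_derive1_mul (is_derive_cst D p 1) rd.
  apply: is_derive_eq (is_derive1_div Drd sd sN) _.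
  (* [field] treats the root [r] as an atom, so [m2] is eliminated in favour of [s] and [r]
     first. *)
  have m2E : m2 = s ^+ 2 - r ^+ 2 by rewrite r2; ring.
  transitivity (D * (s ^+ 2 - r ^+ 2) / (r * s ^+ 2)); last by rewrite -m2E.
  by rewrite /=; field; rewrite sN.
have hd := is_derive_enthalpy eP p0 rho_of_gt0 rhod.
rewrite /pressure_eq; apply: is_derive_eq.
have -> : (rho_of p)^-1 = s / r / D by rewrite /rho_of; field; rewrite ?rN ?sN ?DN.
by rewrite /GRing.scale /=; ring.
Qed.

(** Nonpositivity means [h <= r / D], so [T = D m2 / (r s^2)] satisfies [h T <= m2 / s^2 <= 1].
    Multiplied by [h], the derivative is [- h (1/rho - dp h) + drho h (h T)], which exceeds
    [- drho h (1 - h T) >= 0] by the lower bound on [drho h]. *)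
Lemma pressure_eq_incr : pressure_eq p <= 0 ->
  0 < dp h p (rho_of p) - (rho_of p)^-1
      + drho h p (rho_of p) * (D * m2 / (r * s ^+ 2)).
Proof.
have rho0 := rho_of_gt0.
have h0 := enthalpy_gt0 eP p0 rho0.
have hr0 := eos_drho_lt0 eP p0 rho0.
have hd := eos_drho_gt eP p0 rho0.
rewrite /pressure_eq subr_le0 => hle.
set H := h p _ in h0 hd hle *; set hr := drho _ _ _ in hr0 hd *.
set hp := dp _ _ _ in hd *.
rewrite -(pmulr_rgt0 _ h0).
suff : H * (D * m2 / (r * s ^+ 2)) <= 1 by nra.
have : m2 / s ^+ 2 <= 1 by rewrite ler_pdivrMr ?exprn_gt0 // mul1r ltW.
have : H * D / r <= 1 by rewrite ler_pdivrMr // mul1r -ler_pdivlMr.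
have -> : H * (D * m2 / (r * s ^+ 2)) = H * D / r * (m2 / s ^+ 2).
  by field; rewrite !lt0r_neq0.
have : 0 <= m2 / s ^+ 2 by rewrite divr_ge0 // sqr_ge0.
have : 0 <= H * D / r by rewrite divr_ge0 ?mulr_ge0 // ltW.
nra.
Qed.

End At.
End Recovery.

Lemma derive_gt0_left (R : realType) (f : R -> R) (x a d : R) :
  is_derive x 1 f d -> 0 < d -> a < x -> exists2 y, a < y < x & f y < f x.
Proof.
move=> [fd fv] d0 ax.
have lim : (fun h : R => h^-1 *: ((f \o shift x) (h *: 1) - f x)) @ 0^' --> d.
  by rewrite -fv; exact: fd.
have : \forall h \near 0^', 0 < h^-1 *: ((f \o shift x) (h *: 1) - f x).
  exact: (cvgr_gt d).
move=> /nbhs_ballP[eps /= eps0 He].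
pose k := Num.min (eps / 2) ((x - a) / 2).
have k0 : 0 < k by rewrite lt_min; apply/andP; split; lra.
have ke : k < eps by rewrite gt_min; apply/orP; left; lra.
have kx : k < x - a by rewrite gt_min; apply/orP; right; lra.
exists (x - k); first by apply/andP; split; lra.
have := He (- k); rewrite /ball /= sub0r opprK gtr0_norm // oppr_eq0 gt_eqF //.
move=> /(_ ke isT); rewrite /GRing.scale /= mulr1 invrN mulNr -mulrN.
by rewrite pmulr_rgt0 ?invr_gt0 // opprB subr_gt0 addrC.
Qed.

Section Uniqueness.
Variables (R : realType) (e : R -> R -> R) (D E m2 : R).
Hypotheses (eP : is_eos e) (D0 : 0 < D) (m20 : 0 <= m2).
Local Notation h := (enthalpy e).
Local Notation psi := (pressure_eq e D E m2).

(** Consider a minimum of [psi] on the segment between two distinct roots. If it is zero, the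
    positive derivative at [p2] yields a smaller value just to the left of [p2]. If it is negative,
    it is interior with derivative zero, although the derivative is positive wherever [psi <= 0]. *)
Lemma pressure_eq_inj (p1 p2 : R) :
  0 < p1 -> 0 < E + p1 -> m2 < (E + p1) ^+ 2 -> psi p1 = 0 ->
  0 < p2 -> 0 < E + p2 -> m2 < (E + p2) ^+ 2 -> psi p2 = 0 -> p1 = p2.
Proof.
wlog : p1 p2 / p1 <= p2.
  move=> H p10 s10 ms1 z1 p20 s20 ms2 z2.
  case/orP: (le_total p1 p2) => [/H|/H E21]; first exact.
  by symmetry; exact: E21.
rewrite le_eqVlt => /predU1P[//|p12] p10 s10 ms1 z1 p20 s20 ms2 z2; exfalso.
pose dpsi p := dp h p (rho_of D E m2 p) - (rho_of D E m2 p)^-1 +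
  drho h p (rho_of D E m2 p) *
  (D * m2 / (Num.sqrt ((E + p) ^+ 2 - m2) * (E + p) ^+ 2)).
have sp p : p1 <= p -> [/\ 0 < p, 0 < E + p & m2 < (E + p) ^+ 2].
  move=> pp; have Ep : E + p1 <= E + p by rewrite lerD2l.
  split; [exact: lt_le_trans pp|exact: lt_le_trans Ep|].
  by apply: lt_le_trans ms1 _; rewrite ler_sqr // nnegrE ltW // (lt_le_trans s10).
have der p : p1 <= p -> is_derive p 1 psi (dpsi p).
  by move=> /sp[p0 s0 ms]; exact: is_derive_pressure_eq.
have inc p : p1 <= p -> psi p <= 0 -> 0 < dpsi p.
  by move=> /sp[p0 s0 ms]; exact: pressure_eq_incr.
have [||c] := @EVT_min _ psi p1 p2; first exact: ltW.
  apply: derivable_within_continuous => x; rewrite in_itv /= => /andP[/der px _].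
  exact: ex_derive.
rewrite in_itv /= => /andP[c1 c2] cmin.
have c0 : psi c <= 0 by rewrite -z1 cmin // in_itv /= lexx ltW.
move: c0; rewrite le_eqVlt => /predU1P[c0|c0].
  have z2' : psi p2 <= 0 by rewrite z2.
  have [y /andP[y1 y2]] :=
    derive_gt0_left (der _ (ltW p12)) (inc _ (ltW p12) z2') p12.
  by rewrite z2 ltNge -c0 cmin // in_itv /= !ltW.
have cp1 : p1 < c by rewrite lt_neqAle c1 andbT; apply: contraTneq c0 => <-; rewrite z1 ltxx.
have cp2 : c < p2 by rewrite lt_neqAle c2 andbT; apply: contraTneq c0 => ->; rewrite z2 ltxx.
have dc0 : is_derive c 1 psi 0.
  apply: (@derive1_at_min _ psi p1 p2) => //; first exact: ltW.
  - move=> t; rewrite in_itv /= => /andP[/ltW /der dt _].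
    exact: (ex_derive (is_derive := dt)).
  - by rewrite in_itv /= cp1.
  - by move=> t; rewrite in_itv /= => /andP[t1 t2]; apply: cmin; rewrite in_itv /= !ltW.
have := inc _ c1 (ltW c0).
rewrite -(derive_val (is_derive := der _ c1)) (derive_val (is_derive := dc0)).
by rewrite ltxx.
Qed.
End Uniqueness.

Section Existence.
Variables (R : realType) (e : R -> R -> R) (D E m2 : R).
Hypotheses (eP : is_eos e) (D0 : 0 < D) (m20 : 0 <= m2).
Hypothesis DE : Num.sqrt (D ^+ 2 + m2) < E.
Local Notation h := (enthalpy e).
Local Notation psi := (pressure_eq e D E m2).

Let E0 : 0 < E. Proof. exact: le_lt_trans (sqrtr_ge0 _) DE. Qed.

Let DE2 : D ^+ 2 + m2 < E ^+ 2.
Proof.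
rewrite -[ltLHS]sqr_sqrtr; last by rewrite addr_ge0 ?sqr_ge0.
by rewrite ltr_sqr ?nnegrE ?sqrtr_ge0 ?ltW.
Qed.

Let ms p : 0 <= p -> m2 < (E + p) ^+ 2.
Proof.
move=> p0; have : E ^+ 2 <= (E + p) ^+ 2.
  by rewrite ler_sqr ?nnegrE ?addr_ge0 ?lerDl // ltW.
by have := sqr_ge0 D; have := DE2; lra.
Qed.

Let rho0 := rho_of D E m2 0.

Let rho00 : 0 < rho0.
Proof. by apply: rho_of_gt0 => //; rewrite ?addr0 //; have := ms (lexx 0); rewrite addr0. Qed.

(** [rho_of] is [D] times the root of [1 - m2 / (E + p)^2], hence grows with [p] and stays between
    [rho0] and [D]. As [h] decreases in the density, these two constants replace the moving density
    in the limits [p -> 0] and [p -> +oo]. *)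
Let rho0_le p : 0 <= p -> rho0 <= rho_of D E m2 p.
Proof.
move=> p0; have s0 : 0 < E + p by rewrite ltr_pwDl.
rewrite /rho0 /rho_of addr0 ler_pdivrMr // mulrAC ler_pdivlMr //.
rewrite -!mulrA ler_pM2l //.
have rE q : 0 < q -> 0 <= q ^+ 2 - m2 -> forall t, 0 <= t ->
    Num.sqrt (q ^+ 2 - m2) * t = Num.sqrt ((q ^+ 2 - m2) * t ^+ 2).
  by move=> q0 q1 t t0; rewrite sqrtrM // sqrtr_sqr ger0_norm.
have E2 := ms (lexx 0); have s2 := ms p0; rewrite addr0 in E2.
rewrite !rE ?subr_ge0 ?(ltW E0) ?(ltW s0) ?(ltW E2) ?(ltW s2) //.
apply: ler_wsqrtr; rewrite !mulrBl [X in X - _ <= _]mulrC lerD2l lerN2.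
by rewrite ler_wpM2l // ler_sqr ?nnegrE ?lerDl // ?(ltW E0) ?(ltW s0).
Qed.

Let rho_le p : 0 <= p -> rho_of D E m2 p <= D.
Proof.
move=> p0; have s0 : 0 < E + p by rewrite ltr_pwDl.
rewrite /rho_of ler_pdivrMr // ler_pM2l // -[leRHS]gtr0_norm //.
by rewrite -sqrtr_sqr ler_wsqrtr // gerBl.
Qed.

(** As [p] tends to [0], [h p rho0] tends to [1], while [K > 1] is exactly the admissibility of the
    state. Half of the gap [K - 1] is left to [e] and half to [p / rho0]. *)
Let psi_neg : \forall p \near 0^'+, psi p < 0.
Proof.
pose K := Num.sqrt (E ^+ 2 - m2) / D.
have K1 : 1 < K.
  rewrite ltr_pdivlMr // mul1r -[ltLHS]gtr0_norm // -sqrtr_sqr ltr_sqrt.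
    by rewrite ltrBrDr.
  by rewrite subr_gt0; have := ms (lexx 0); rewrite addr0.
have k0 : 0 < (K - 1) / 2 by lra.
have e0 : \forall p \near 0^'+, e p rho0 < (K - 1) / 2.
  by apply: (cvgr_lt 0) => //; exact: (eos_lim0 eP rho00).
near=> p.
have p0 : 0 < p by near: p; exact: nbhs_right_gt.
have ep : e p rho0 < (K - 1) / 2 by near: p.
have pr : p < rho0 * ((K - 1) / 2).
  by near: p; apply: nbhs_right_lt; rewrite mulr_gt0.
have hle := enthalpy_decr eP p0 rho00 (rho0_le (ltW p0)).
have h1 : h p rho0 < K.
  by rewrite /enthalpy; move: pr; rewrite mulrC -ltr_pdivrMr //; lra.
rewrite /pressure_eq subr_lt0; apply: le_lt_trans hle _; apply: lt_le_trans h1 _.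
rewrite ler_pM2r ?invr_gt0 // ler_wsqrtr // lerD2r ler_sqr ?nnegrE ?lerDl ?(ltW E0) ?(ltW p0) //.
by rewrite ltW // addr_gt0.
Unshelve. all: by end_near. Qed.

(** At density [D] the term [p / D] of the enthalpy cancels the growth of [(E + p) / D], so it
    suffices that [e p D] eventually exceeds [E / D]. *)
Let psi_pos : \forall p \near +oo, 0 < psi p.
Proof.
have e1 : \forall p \near +oo, E / D < e p D.
  by have /cvgryPgt := eos_limy eP D0; apply.
near=> p.
have p0 : 0 < p by near: p; exact: nbhs_pinfty_gt.
have ep : E / D < e p D by near: p.
have rho0p : 0 < rho_of D E m2 p.
  by apply: rho_of_gt0 => //; [exact: addr_gt0|exact/ms/ltW].
have hle := enthalpy_decr eP p0 rho0p (rho_le (ltW p0)).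
rewrite /pressure_eq subr_gt0; apply: lt_le_trans hle.
have : Num.sqrt ((E + p) ^+ 2 - m2) / D <= (E + p) / D.
  rewrite ler_pM2r ?invr_gt0 // -[leRHS]gtr0_norm ?addr_gt0 //.
  by rewrite -sqrtr_sqr ler_wsqrtr // gerBl.
rewrite mulrDl /enthalpy; lra.
Unshelve. all: by end_near. Qed.

Lemma pressure_eq_root : exists2 p : R, 0 < p & psi p = 0.
Proof.
near (0 : R)^'+ => a; near (pinfty_nbhs R) => b.
have a0 : 0 < a by near: a; exact: nbhs_right_gt.
have ab : a <= b by near: b; apply: nbhs_pinfty_ge; exact: num_real.
have za : psi a < 0 by near: a.
have zb : 0 < psi b by near: b.
have [||c] := @IVT _ psi a b 0 ab.
- apply: derivable_within_continuous => x; rewrite in_itv /= => /andP[ax _].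
  have x0 := lt_le_trans a0 ax.
  have dx := is_derive_pressure_eq eP D0 x0
    (addr_gt0 E0 x0) (ms (ltW x0)).
  exact: (ex_derive (is_derive := dx)).
- by rewrite ge_min le_max (ltW za) (ltW zb) orbT.
rewrite in_itv /= => /andP[ac _] zc; exists c => //.
exact: lt_le_trans ac.
Unshelve. all: by end_near. Qed.

End Existence.

(** * The metric, states and primitive variables *)

Section Metric.
Variables (R : realType) (gam : 'M[R]_3).
Hypothesis gamP : is_metric gam.
Implicit Types a b c : 'rV[R]_3.
Local Notation dot := (codot gam).

Lemma metric_unit : gam \in unitmx.
Proof.
rewrite -row_free_unit -kermx_eq0; apply/eqP/row_matrixP => i.
rewrite row0; apply/eqP; apply: contraT => /(proj2 gamP).
have -> : row i (kermx gam) *m gam = 0 by rewrite -row_mul mulmx_ker row0.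
by rewrite mul0mx mxE ltxx.
Qed.

Lemma codotC a b : dot a b = dot b a.
Proof.
rewrite /codot -[in LHS](trmxK (a *m _ *m _)) mxE !trmx_mul trmxK mulmxA.
by rewrite trmx_inv (proj1 gamP).
Qed.

Lemma codotDl a b c : dot (a + b) c = dot a c + dot b c.
Proof. by rewrite /codot !mulmxDl mxE. Qed.

Lemma codotZl k a b : dot (k *: a) b = k * dot a b.
Proof. by rewrite /codot -!scalemxAl mxE. Qed.

Lemma codotDr a b c : dot a (b + c) = dot a b + dot a c.
Proof. by rewrite codotC codotDl !(codotC a). Qed.

Lemma codotZr k a b : dot a (k *: b) = k * dot a b.
Proof. by rewrite codotC codotZl codotC. Qed.

Lemma codot_gt0 a : a != 0 -> 0 < dot a a.
Proof.
(* Writing the covector as [y gam] turns the inverse form at [a] into the form of [gam] at [y]. *)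
have [y ->] : exists y, a = y *m gam.
  by exists (a *m invmx gam); rewrite mulmxKV ?metric_unit.
move=> yg0; have y0 : y != 0 by apply: contraNneq yg0 => ->; rewrite mul0mx.
rewrite /codot mulmxK ?metric_unit // trmx_mul (proj1 gamP) mulmxA.
exact: proj2 gamP _ y0.
Qed.

Lemma codot_ge0 a : 0 <= dot a a.
Proof.
have [->|/codot_gt0/ltW//] := eqVneq a 0.
by rewrite /codot !mul0mx mxE.
Qed.

Lemma codot_CauchySchwarz a b : dot a b ^+ 2 <= dot a a * dot b b.
Proof.
have [->|b0] := eqVneq b 0; first by rewrite /codot trmx0 !mulmx0 !mxE mulr0 expr2 mulr0.
have bb := codot_gt0 b0.
have := codot_ge0 (dot b b *: a + (- dot a b) *: b).
rewrite !(codotDl, codotDr, codotZl, codotZr) (codotC b a).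
set x := dot a b; set y := dot a a; set z := dot b b in bb * => H.
have : 0 <= z * (y * z - x ^+ 2) by lra.
by rewrite pmulr_rge0 // subr_ge0.
Qed.

Lemma speed_sqr v : speed gam v ^+ 2 = dot v v.
Proof. by rewrite sqr_sqrtr ?codot_ge0. Qed.

Lemma speed_lt1 v : (speed gam v < 1) = (dot v v < 1).
Proof.
by rewrite -[1 in LHS]sqrtr1 /speed ltr_sqrt.
Qed.

Lemma pairing_raise xi v : pairing xi (raise gam v) = dot xi v.
Proof.
rewrite codotC /pairing /codot mxE; apply: eq_bigr => j _.
by rewrite mulrC [xi^T _ _]mxE.
Qed.

Section Lorentz.
Variable v : 'rV[R]_3.
Hypothesis v1 : dot v v < 1.
Local Notation w := (lorentz gam v).

Lemma lorentz_gt0 : 0 < w.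
Proof. by rewrite invr_gt0 sqrtr_gt0 speed_sqr subr_gt0. Qed.

Lemma lorentz_sqr : w ^+ 2 = (1 - dot v v)^-1.
Proof. by rewrite exprVn speed_sqr sqr_sqrtr // subr_ge0 ltW. Qed.

End Lorentz.
End Metric.

Section States.
Variable R : realType.
Implicit Types (D E k : R) (m : 'rV[R]_3).

Lemma sD_mkstate D m E : sD (mkstate D m E) = D.
Proof. by rewrite /sD row_mxKl mxE eqxx. Qed.

Lemma sm_mkstate D m E : sm (mkstate D m E) = m.
Proof. by rewrite /sm row_mxKr row_mxKl. Qed.

Lemma sE_mkstate D m E : sE (mkstate D m E) = E.
Proof. by rewrite /sE !row_mxKr mxE eqxx. Qed.

Definition mkstateE := (sD_mkstate, sm_mkstate, sE_mkstate).

Lemma mkstate_eta (U : state R) : U = mkstate (sD U) (sm U) (sE U).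
Proof.
by rewrite /mkstate /sD /sm /sE -!mx11_scalar !hsubmxK.
Qed.

Lemma mkstateD D m E D' m' E' :
  mkstate D m E + mkstate D' m' E' = mkstate (D + D') (m + m') (E + E').
Proof. by rewrite /mkstate !add_row_mx !raddfD. Qed.

Lemma mkstateZ k D m E :
  k *: mkstate D m E = mkstate (k * D) (k *: m) (k * E).
Proof. by rewrite /mkstate !scale_row_mx !scale_scalar_mx. Qed.

Lemma mkstate_inj D m E D' m' E' :
  mkstate D m E = mkstate D' m' E' -> [/\ D = D', m = m' & E = E'].
Proof.
move=> H; split.
- by rewrite -(sD_mkstate D m E) H mkstateE.
- by rewrite -(sm_mkstate D m E) H mkstateE.
- by rewrite -(sE_mkstate D m E) H mkstateE.
Qed.

End States.

Section Primitive.
Variables (R : realType) (e : R -> R -> R) (gam : 'M[R]_3).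
Hypotheses (gamP : is_metric gam) (eP : is_eos e).
Local Notation h := (enthalpy e).
Local Notation dot := (codot gam).
Local Notation w := (lorentz gam).

(** With [E = q - p] one has [E + p = q], and the root of [q^2 - |m|^2] is [q / w]. So the pressure
    of any primitive triple solves the scalar equation attached to its conservative state, which
    reduces uniqueness of the triple to [pressure_eq_inj]. *)
Lemma prim_pressure rho v p : is_prim gam (rho, v, p) ->
  let q := rho * h p rho * w v ^+ 2 in
  [/\ 0 < q, dot (q *: v) (q *: v) < q ^+ 2,
      rho_of (rho * w v) (q - p) (dot (q *: v) (q *: v)) p = rho &
      pressure_eq e (rho * w v) (q - p) (dot (q *: v) (q *: v)) p = 0].
Proof.
move=> [r0 p0]; rewrite speed_lt1 // => v1 q.
have w0 := lorentz_gt0 gamP v1; have h0 := enthalpy_gt0 eP p0 r0.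
have q0 : 0 < q by rewrite !mulr_gt0 // exprn_gt0.
have wN := lt0r_neq0 w0; have rN := lt0r_neq0 r0; have qN := lt0r_neq0 q0.
rewrite codotZl // codotZr // mulrA -expr2.
have sq : Num.sqrt ((q - p + p) ^+ 2 - q ^+ 2 * dot v v) = q / w v.
  rewrite subrK -[X in X - _]mulr1 -mulrBr.
  have -> : 1 - dot v v = w v ^- 2 by rewrite lorentz_sqr // invrK.
  by rewrite -exprVn -exprMn sqrtr_sqr gtr0_norm // divr_gt0.
have rE : rho_of (rho * w v) (q - p) (q ^+ 2 * dot v v) p = rho.
  by rewrite /rho_of sq subrK; field; rewrite qN.
split => //; first by rewrite gtr_pMr // exprn_gt0.
by rewrite /pressure_eq rE sq /q; field; rewrite wN.
Qed.

Lemma conservative_inj W1 W2 : is_prim gam W1 -> is_prim gam W2 ->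
  conservative e gam W1 = conservative e gam W2 -> W1 = W2.
Proof.
case: W1 W2 => [[r1 v1] p1] [[r2 v2] p2] P1 P2 /mkstate_inj[].
have [q10 m1 rE1 z1] := prim_pressure P1.
have [q20 m2 rE2 z2] := prim_pressure P2.
case: P1 P2 => [r10 p10 v11] [r20 p20 v21].
set q1 := _ * w v1 ^+ 2 in q10 m1 rE1 z1 *.
set q2 := _ * w v2 ^+ 2 in q20 m2 rE2 z2 *.
move=> ED Em EE.
rewrite -ED -Em -EE in rE2 z2.
have E2 : q1 - p1 + p2 = q2 by rewrite EE subrK.
have pE : p1 = p2.
  apply: (pressure_eq_inj eP _ _ p10 _ _ z1 p20 _ _ z2); rewrite ?subrK ?E2 //.
  - by rewrite mulr_gt0 // lorentz_gt0 // -speed_lt1.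
  - exact: codot_ge0.
  - by rewrite Em.
have qE : q1 = q2 by rewrite -E2 pE subrK.
rewrite -rE1 -rE2 pE; congr (_, _, _).
have : q1 *: v1 = q1 *: v2 by rewrite Em qE.
by move/(congr1 ( *:%R q1^-1)); rewrite !scalerA mulVf ?scale1r // lt0r_neq0.
Qed.

(** From a root [p], with [s = E + p] and [r] the root of [s^2 - |m|^2], take [v = m / s], so that
    [w = s / r]. The root equation says [h = r / D], and with [rho = D r / s] this gives
    [rho h w^2 = s]. *)
Lemma conservative_surj U : admissible gam U ->
  exists2 W, is_prim gam W & conservative e gam W = U.
Proof.
rewrite {2}(mkstate_eta U); case; set D := sD U; set m := sm U; set E := sE U.
rewrite subr_gt0 => D0 DE; have m20 := codot_ge0 gamP m.
have [p p0 z] := pressure_eq_root eP D0 m20 DE.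
have DE2 : D ^+ 2 + dot m m < E ^+ 2.
  rewrite -[ltLHS]sqr_sqrtr; last by rewrite addr_ge0 ?sqr_ge0.
  by rewrite ltr_sqr ?nnegrE ?sqrtr_ge0 // ltW // (le_lt_trans _ DE) ?sqrtr_ge0.
have E0 : 0 < E by apply: le_lt_trans (sqrtr_ge0 _) DE.
pose s := E + p.
have s0 : 0 < s by rewrite addr_gt0.
have ms : dot m m < s ^+ 2.
  have : E ^+ 2 < s ^+ 2 by rewrite ltr_sqr ?nnegrE ?(ltW E0) ?(ltW s0) // ltrDl.
  by have := sqr_ge0 D; lra.
pose r := Num.sqrt (s ^+ 2 - dot m m).
have r0 : 0 < r by rewrite sqrtr_gt0 subr_gt0.
have sN := lt0r_neq0 s0; have rN := lt0r_neq0 r0; have DN := lt0r_neq0 D0.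
have rho0 : 0 < rho_of D E (dot m m) p by exact: rho_of_gt0.
have vv : dot (s^-1 *: m) (s^-1 *: m) = dot m m / s ^+ 2.
  by rewrite codotZl // codotZr //; field.
have v1 : dot (s^-1 *: m) (s^-1 *: m) < 1.
  by rewrite vv ltr_pdivrMr ?exprn_gt0 // mul1r.
have wE : w (s^-1 *: m) = s / r.
  rewrite /lorentz speed_sqr // vv.
  have -> : 1 - dot m m / s ^+ 2 = (s ^+ 2 - dot m m) * s^-1 ^+ 2 by field.
  rewrite sqrtrM ?subr_ge0 ?ltW // sqrtr_sqr gtr0_norm ?invr_gt0 // -/r.
  by rewrite invfM invrK mulrC.
have zE : h p (rho_of D E (dot m m) p) = r / D.
  by apply/eqP; rewrite -subr_eq0; apply/eqP.
have qE : rho_of D E (dot m m) p * h p (rho_of D E (dot m m) p)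
    * w (s^-1 *: m) ^+ 2 = s.
  by rewrite zE wE /rho_of -/s -/r; field; rewrite ?rN ?sN ?DN.
exists (rho_of D E (dot m m) p, s^-1 *: m, p).
  by split => //; rewrite speed_lt1.
rewrite /conservative qE scalerA mulfV // scale1r wE.
congr mkstate; last by rewrite /s addrK.
by rewrite /rho_of -/s -/r; field; rewrite ?rN ?sN.
Qed.

Lemma primitiveK W : is_prim gam W -> primitive e gam (conservative e gam W) = W.
Proof.
move=> WP; have [] : [set W' | is_prim gam W' /\ conservative e gam W' =
    conservative e gam W] (primitive e gam (conservative e gam W)).
  by apply: getPex; exists W.
by move=> P E; exact: conservative_inj E.
Qed.

End Primitive.

(** * The acoustic speed *)

Section AcousticSpeed.
Variable R : realType.
Implicit Types c vv V zz t mu : R.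

(* The largest characteristic speed relative to [beta] in a direction [xi]
   with [V = xi_j v^j] and [zz = xi_j xi^j], as a function of the sound speed
   [c] and of [vv = v_j v^j]. *)
Definition acoustic c vv V zz : R :=
  (1 - vv * c ^+ 2)^-1 *
  (`|V| * (1 - c ^+ 2) + c * Num.sqrt (1 - vv)
    * Num.sqrt ((1 - vv * c ^+ 2) * zz - (1 - c ^+ 2) * V ^+ 2)).

(** Degree one in the direction turns the condition [|t| S < 1] into a bound by [1] on the speed in
    direction [t xi]. *)
Lemma acoustic_homogeneous c vv V zz t :
  acoustic c vv (t * V) (t ^+ 2 * zz) = `|t| * acoustic c vv V zz.
Proof.
rewrite /acoustic normrM.
have -> : (1 - vv * c ^+ 2) * (t ^+ 2 * zz) - (1 - c ^+ 2) * (t * V) ^+ 2 =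
   t ^+ 2 * ((1 - vv * c ^+ 2) * zz - (1 - c ^+ 2) * V ^+ 2) by ring.
by rewrite sqrtrM ?sqr_ge0 // sqrtr_sqr; ring.
Qed.

Variables c vv V zz : R.
Hypotheses (c0 : 0 < c) (c1 : c ^+ 2 < 1) (v21 : vv < 1).
Hypotheses (z20 : 0 <= zz) (Vz : V ^+ 2 <= vv * zz).
Let k := 1 - vv * c ^+ 2.
Let Delta := k * zz - (1 - c ^+ 2) * V ^+ 2.
Let s := c * Num.sqrt (1 - vv) * Num.sqrt Delta.

Let c20 : 0 < c ^+ 2. Proof. exact: exprn_gt0. Qed.

Let k0 : 0 < k.
Proof.
have : vv * c ^+ 2 <= c ^+ 2 by rewrite ler_piMl // ltW.
by have := c1; rewrite /k; lra.
Qed.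

Let Vz1 : V ^+ 2 <= zz. Proof. by apply: le_trans Vz _; rewrite ler_piMl // ltW. Qed.

Let Delta0 : 0 <= Delta.
Proof.
have : k * V ^+ 2 <= k * zz by rewrite ler_pM2l.
have : (1 - c ^+ 2) * V ^+ 2 <= k * V ^+ 2.
  by rewrite ler_wpM2r ?sqr_ge0 // /k lerD2l lerN2 ler_piMl // ltW.
rewrite /Delta; lra.
Qed.

Let s0 : 0 <= s. Proof. by rewrite !mulr_ge0 ?sqrtr_ge0 // ltW. Qed.

Let s2 : s ^+ 2 = c ^+ 2 * (1 - vv) * Delta.
Proof. by rewrite !exprMn !sqr_sqrtr // subr_ge0 ltW. Qed.

Let acousticE : acoustic c vv V zz = (`|V| * (1 - c ^+ 2) + s) / k.
Proof. by rewrite /acoustic mulrC. Qed.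

(** After clearing the denominator the claim is [|V| c^2 (1 - vv) <= s], and the difference of the
    squares is [c^2 (1 - vv) k (zz - V^2)]. It shows that the material eigenvalue never exceeds the
    acoustic one. *)
Lemma acoustic_bound : `|V| <= acoustic c vv V zz.
Proof.
rewrite acousticE ler_pdivlMr //.
have : `|V| * (c ^+ 2 * (1 - vv)) <= s.
  have a0 : 0 <= c ^+ 2 * (1 - vv) by rewrite mulr_ge0 ?subr_ge0 // ltW.
  rewrite -ler_sqr ?nnegrE ?(mulr_ge0 _ a0) // s2 exprMn real_normK ?num_real //.
  have : k * V ^+ 2 <= k * zz by rewrite ler_pM2l.
  move=> H; rewrite -subr_ge0.
  have -> : c ^+ 2 * (1 - vv) * Delta - V ^+ 2 * (c ^+ 2 * (1 - vv)) ^+ 2 =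
     c ^+ 2 * (1 - vv) * (k * zz - k * V ^+ 2) by rewrite /Delta /k; ring.
  by rewrite mulr_ge0 ?subr_ge0.
rewrite /k; lra.
Qed.

Lemma acoustic_gt0 : 0 < zz -> 0 < acoustic c vv V zz.
Proof.
move=> zp; have [V0|VN] := eqVneq V 0; last first.
  by apply: lt_le_trans acoustic_bound; rewrite normr_gt0.
rewrite acousticE V0 normr0 mul0r add0r divr_gt0 //.
rewrite !mulr_gt0 ?sqrtr_gt0 ?subr_gt0 //.
by rewrite V0 expr0n mulr0 mulr_gt0.
Qed.

(** With [z] the root of [zz], the difference of squares [(z k - |V| (1 - c^2))^2 - s^2] is
    [k (1 - c^2) (z - |V|)^2], and [|V| < z] by the Cauchy-Schwarz hypothesis and [vv < 1]. *)
Lemma acoustic_lt : 0 < zz -> acoustic c vv V zz < Num.sqrt zz.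
Proof.
move=> zp; rewrite acousticE ltr_pdivrMr //.
set z := Num.sqrt zz.
have zsq : z ^+ 2 = zz by rewrite sqr_sqrtr.
have z0 : 0 < z by rewrite sqrtr_gt0.
have Vltz : `|V| < z.
  rewrite -ltr_sqr ?nnegrE // ?ltW // real_normK ?num_real // zsq.
  by apply: le_lt_trans Vz _; rewrite gtr_pMl.
rewrite addrC -ltrBrDr -ltr_sqr ?nnegrE //; last first.
  rewrite subr_ge0 /k.
  have : `|V| * (1 - c ^+ 2) <= z * (1 - c ^+ 2).
    by rewrite ler_wpM2r ?subr_ge0 // ltW.
  have : z * (1 - c ^+ 2) <= z * (1 - vv * c ^+ 2) by rewrite ler_pM2l // lerD2l lerN2 ler_piMl // ltW.
  lra.
rewrite s2 -subr_gt0.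
have -> : (z * k - `|V| * (1 - c ^+ 2)) ^+ 2 - c ^+ 2 * (1 - vv) * Delta =
    k * (1 - c ^+ 2) * (z - `|V|) ^+ 2.
  rewrite /Delta -zsq -(real_normK (num_real V)) /k; ring.
apply: mulr_gt0; last by rewrite exprn_gt0 // subr_gt0.
by rewrite mulr_gt0 // subr_gt0.
Qed.

(** Isolating [s] and squaring leaves a difference divisible by [k > 0]; the quotient is the second
    conclusion. In this polynomial form the speed bound can be compared with the ideal enthalpy
    estimate. *)
Lemma acoustic_lt1 : acoustic c vv V zz < 1 ->
  `|V| < 1 /\
  c ^+ 2 * (1 - vv) * (zz - 1) < (1 - c ^+ 2) * (1 - `|V|) ^+ 2.
Proof.
move=> S1; have V1 : `|V| < 1 by exact: le_lt_trans acoustic_bound _.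
split => //; move: S1; rewrite acousticE ltr_pdivrMr // mul1r => S1.
have : s ^+ 2 < (k - `|V| * (1 - c ^+ 2)) ^+ 2.
  by rewrite ltr_sqr ?nnegrE //; have := s0; lra.
rewrite s2 -subr_gt0.
have -> : (k - `|V| * (1 - c ^+ 2)) ^+ 2 - c ^+ 2 * (1 - vv) * Delta =
  k * ((1 - c ^+ 2) * (1 - `|V|) ^+ 2 - c ^+ 2 * (1 - vv) * (zz - 1)).
  by rewrite /Delta -(real_normK (num_real V)) /k; ring.
by rewrite pmulr_rgt0 // subr_gt0.
Qed.

Lemma acoustic_sqrt_sqr :
  (c * Num.sqrt (1 - vv) * Num.sqrt Delta) ^+ 2 = c ^+ 2 * (1 - vv) * Delta.
Proof. exact: s2. Qed.

(** The two left sides are the moduli of the roots of the acoustic quadratic; the triangle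
    inequality bounds both numerators. *)
Lemma acoustic_root_bound :
  (`|V * (1 - c ^+ 2) + s| / k <= acoustic c vv V zz) /\
  (`|V * (1 - c ^+ 2) - s| / k <= acoustic c vv V zz).
Proof.
have E : `|V| * (1 - c ^+ 2) + s = `|V * (1 - c ^+ 2)| + `|s|.
  by rewrite normrM (ger0_norm s0) (@gtr0_norm _ (1 - _)) // subr_gt0.
rewrite acousticE E !ler_pM2r ?invr_gt0 //.
by split; [exact: ler_normD|exact: ler_normB].
Qed.

End AcousticSpeed.

(** * Admissibility of the split states *)

Section FluxAdmissibility.
Variables (R : realType) (e : R -> R -> R) (gam : 'M[R]_3).
Hypotheses (gamP : is_metric gam) (eP : is_eos e).
Local Notation h := (enthalpy e).
Local Notation dot := (codot gam).
Local Notation w := (lorentz gam).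

Lemma admissibleP (U : state R) : admissible gam U <->
  [/\ 0 < sD U, 0 < sE U & sD U ^+ 2 + dot (sm U) (sm U) < sE U ^+ 2].
Proof.
have s0 : 0 <= sD U ^+ 2 + dot (sm U) (sm U).
  by rewrite addr_ge0 ?sqr_ge0 ?codot_ge0.
rewrite /admissible /= subr_gt0; split => [[D0 DE]|[D0 E0 DE]].
  have E0 := le_lt_trans (sqrtr_ge0 _) DE.
  split => //; rewrite -[ltLHS]sqr_sqrtr //.
  by rewrite ltr_sqr ?nnegrE ?sqrtr_ge0 // ltW.
split => //; rewrite -[ltRHS]gtr0_norm // -sqrtr_sqr ltr_sqrt //.
exact: exprn_gt0.
Qed.

Lemma admissible_scale (U : state R) k :
  0 < k -> admissible gam U -> admissible gam (k *: U).
Proof.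
move=> k0 /admissibleP[D0 E0 DE]; rewrite [U]mkstate_eta mkstateZ.
apply/admissibleP; rewrite !mkstateE; split; rewrite ?mulr_gt0 //.
rewrite codotZl // codotZr // mulrA -expr2 !exprMn -mulrDr.
by rewrite ltr_pM2l // exprn_gt0.
Qed.

(** The flux for zero shift in terms of the primitive variables: the [G] of [F = G - b U]. *)
Definition relative_flux (W : R * 'rV[R]_3 * R) (xi : 'rV[R]_3) : state R :=
  let: (rho, v, p) := W in
  let q := rho * h p rho * w v ^+ 2 in
  let V := dot xi v in
  mkstate (rho * w v * V) (V *: (q *: v) + p *: xi) (q * V).

Lemma dir_flux_conservative (alpha : R) (beta xi : 'rV[R]_3) W :
  is_prim gam W ->
  dir_flux e alpha beta gam xi (conservative e gam W) =
  relative_flux W xi - (pairing xi beta / alpha) *: conservative e gam W.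
Proof.
case: W => [[rho v] p] WP; rewrite /dir_flux /flux primitiveK //.
rewrite /relative_flux -(pairing_raise gamP); move: (raise gam v) => rv.
rewrite /pairing !big_ord_recl !big_ord0.
rewrite /conservative !mkstateE -[X in _ = _ + X]scaleNr !mkstateZ !addr0 !mkstateD.
congr (mkstate _ _ _); [by ring| |by ring].
apply/rowP => i; rewrite !mxE.
have -> : xi 0 i = \sum_j xi 0 j * (delta_mx 0 j : 'rV[R]_3) 0 i.
  by rewrite {1}[xi]row_sum_delta summxE; apply: eq_bigr => j _; rewrite !mxE.
rewrite !big_ord_recl big_ord0 !mxE; ring.
Qed.

Section Core.
Variables (rho p : R) (v : 'rV[R]_3).
Hypothesis WP : is_prim gam (rho, v, p).
Local Notation U := (conservative e gam (rho, v, p)).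
Local Notation cs := (sound_speed e p rho).

(** The quantity assumed positive is [E'^2 - D'^2 - |m'|^2] for the split state in direction
    [t zeta]. At [t = 1] it leaves the sign of [E'] open, so the whole segment is used: [E'] is
    positive at [t = 0] and cannot vanish in between, since a vanishing [E'] would make the quantity
    nonpositive. *)
Lemma admissible_flux (zeta : 'rV[R]_3) :
  `|dot zeta v| < 1 ->
  (forall t, 0 <= t <= 1 ->
    0 < (1 + t * dot zeta v) ^+ 2 * w v ^+ 2
        * (rho ^+ 2 * h p rho ^+ 2 - rho ^+ 2 - 2 * p * rho * h p rho)
      + p ^+ 2 * (1 - t ^+ 2 * dot zeta zeta)) ->
  admissible gam (U + relative_flux (rho, v, p) zeta).
Proof.
case: WP => r0 p0; rewrite speed_lt1 // => v1.
have w0 := lorentz_gt0 gamP v1; have w2 := lorentz_sqr gamP v1.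
have h0 := enthalpy_gt0 eP p0 r0; have hp := enthalpy_gt_2p eP p0 r0.
rewrite /conservative /relative_flux mkstateD.
set H := h p rho in h0 hp *; set V := dot zeta v.
set q := rho * H * w v ^+ 2.
move=> V1 pos.
have aV t : 0 <= t <= 1 -> 0 < 1 + t * V.
  case/andP=> t0 t1; move: V1; rewrite ltr_norml => /andP[V1 _].
  have : - t <= t * V by rewrite -mulrN1 ler_wpM2l // ltW.
  have [->|tn] := eqVneq t 1; first lra.
  have : t < 1 by rewrite lt_neqAle tn.
  lra.
have qp : 2 * p < q.
  have rh : 0 <= rho * H by rewrite ltW // mulr_gt0.
  apply: lt_le_trans hp _; rewrite ler_peMr //.
  by rewrite w2 invf_ge1 ?subr_gt0 // gerBl codot_ge0.
have q0 : 0 < q by lra.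
have key t : 0 <= t <= 1 ->
  (rho * w v * (1 + t * V)) ^+ 2 + dot ((1 + t * V) *: (q *: v) + (t * p) *: zeta)
   ((1 + t * V) *: (q *: v) + (t * p) *: zeta) < (q * (1 + t * V) - p) ^+ 2.
  move=> /pos tpos; rewrite -subr_gt0; apply: lt_le_trans tpos _.
  rewrite !(codotDl, codotDr, codotZl, codotZr) // (codotC gamP v zeta) -/V.
  have -> : dot v v = 1 - (w v ^+ 2)^-1 by rewrite w2 invrK; ring.
  rewrite le_eqVlt; apply/orP; left; apply/eqP.
  by rewrite /q; field; exact: lt0r_neq0.
have I1 : 0 <= (1 : R) <= 1 by rewrite ler01 lexx.
have := key 1 I1; rewrite !mul1r => key1; have := aV 1 I1; rewrite mul1r => a1.
apply/admissibleP; rewrite !mkstateE; split.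
- by rewrite -[X in X + _]mulr1 -mulrDr !mulr_gt0.
- rewrite ltNge; apply/negP => E1.
  have Vneg : V < 0.
    by rewrite ltNge; apply/negP => V0; have := mulr_ge0 (ltW q0) V0; lra.
  (* The parameter at which the energy [q (1 + t V) - p] vanishes. *)
  pose t := (p / q - 1) / V.
  have tV : t * V = p / q - 1 by rewrite /t mulfVK // lt_eqF.
  have t01 : 0 <= t <= 1.
    have pq : p / q <= 1 by rewrite ler_pdivrMr // mul1r; lra.
    apply/andP; split.
      by rewrite /t mulr_le0 ?subr_le0 // invr_le0 ltW.
    rewrite /t ler_ndivrMr // mul1r lerBrDr ler_pdivlMr //; lra.
  have := key t t01; rewrite tV.
  have -> : q * (1 + (p / q - 1)) - p = 0 by field; exact: lt0r_neq0.
  by rewrite expr0n /= ltNge addr_ge0 ?sqr_ge0 ?codot_ge0.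
- move: key1; rewrite !scalerDl scale1r !mulrDr !mulr1 addrA.
  by rewrite -[q *: v + _ + _]addrA; congr (_ < _ ^+ 2); ring.
Qed.

Lemma admissible_flux_general (zeta : 'rV[R]_3) : dot zeta zeta < 1 ->
  admissible gam (U + relative_flux (rho, v, p) zeta).
Proof.
case: WP => r0 p0; rewrite speed_lt1 // => v1 z1.
have w0 := lorentz_gt0 gamP v1.
have z0 := codot_ge0 gamP zeta; have v0 := codot_ge0 gamP v.
apply: admissible_flux.
  rewrite -ltr_sqr ?nnegrE // real_normK ?num_real // expr1n.
  apply: le_lt_trans (codot_CauchySchwarz gamP _ _) _.
  by apply: le_lt_trans z1; rewrite ler_piMr // ltW.
move=> t /andP[t0 t1]; rewrite ltr_wpDl //.
  apply: mulr_ge0; first exact: mulr_ge0 (sqr_ge0 _) (sqr_ge0 _).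
  have := enthalpy_sqr eP p0 r0; lra.
rewrite mulr_gt0 ?exprn_gt0 // subr_gt0; apply: le_lt_trans z1.
by rewrite ler_piMl // expr_le1.
Qed.

End Core.
End FluxAdmissibility.

(** * The ideal equation of state *)

Section IdealEOS.
Variables (R : realType) (e : R -> R -> R) (Gam p rho : R).
Hypotheses (eP : is_eos e) (Gam1 : 1 < Gam) (iP : is_ideal_eos Gam e).
Hypotheses (p0 : 0 < p) (r0 : 0 < rho).
Local Notation h := (enthalpy e).
Local Notation cs := (sound_speed e p rho).

Lemma ideal_dp : dp h p rho = Gam / ((Gam - 1) * rho).
Proof.
rewrite /dp derive1E.
have near_eq : \forall q \near p, h q rho = 1 + Gam * q / ((Gam - 1) * rho).
  by near=> q; apply: iP => //; near: q; exact: lt_nbhsr.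
rewrite (near_eq_derive (1 : R) near_eq).
have H : is_derive p 1 (fun q => 1 + Gam / ((Gam - 1) * rho) * q)
    (Gam / ((Gam - 1) * rho)).
  apply: is_derive_eq; rewrite /GRing.scale /=; ring.
have -> : (fun q => 1 + Gam * q / ((Gam - 1) * rho)) =
  (fun q => 1 + Gam / ((Gam - 1) * rho) * q).
  by apply/funext => q; rewrite mulrAC.
exact: (derive_val (is_derive := H)).
Unshelve. all: by end_near. Qed.

Lemma ideal_drho : drho h p rho = - (Gam * p / ((Gam - 1) * rho ^+ 2)).
Proof.
have g0 : Gam - 1 != 0 by rewrite subr_eq0 gt_eqF.
have rN := lt0r_neq0 r0.
rewrite /drho derive1E.
have near_eq : \forall r \near rho, h p r = 1 + Gam * p / ((Gam - 1) * r).
  by near=> r; apply: iP => //; near: r; exact: lt_nbhsr.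
rewrite (near_eq_derive (1 : R) near_eq).
have gd : is_derive rho 1 (fun r => (Gam - 1) * r) (Gam - 1).
  apply: is_derive_eq; rewrite /GRing.scale /=; ring.
have H := is_derive1_div (is_derive_cst (Gam * p) rho 1) gd (mulf_neq0 g0 rN).
have {}H : is_derive rho 1 (fun r => 1 + Gam * p / ((Gam - 1) * r))
   (- (Gam * p / ((Gam - 1) * rho ^+ 2))).
  by apply: is_derive_eq; rewrite /=; field; rewrite rN.
exact: (derive_val (is_derive := H)).
Unshelve. all: by end_near. Qed.

Lemma ideal_sound_speed : cs ^+ 2 * (rho * h p rho) = Gam * p.
Proof.
have g0 : Gam - 1 != 0 by rewrite subr_eq0 gt_eqF.
have rN := lt0r_neq0 r0.
have := drho_enthalpyE eP p0 r0; rewrite ideal_dp ideal_drho.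
have -> : rho^-1 - Gam / ((Gam - 1) * rho) = - ((Gam - 1) * rho)^-1.
  by field; rewrite rN.
rewrite mulrN => /oppr_inj H.
have : Gam * p / ((Gam - 1) * rho ^+ 2) * ((Gam - 1) * rho ^+ 2) =
  cs ^+ 2 * h p rho * ((Gam - 1) * rho)^-1 * ((Gam - 1) * rho ^+ 2) by rewrite H.
rewrite mulfVK ?mulf_neq0 ?expf_neq0 // => ->.
by field; rewrite rN.
Qed.

(** With [m = 1 / (Gam - 1)] and [P = rho h], one has [P = rho + (1 + m) p] and
    [cs^2 P m = (m + 1) p]. Multiplied by [m P], the difference of the two sides is [p^2 (rho m (2 m
    + 1) + p (m + 1) m (m - 1))], and [m >= 1] is the condition [Gam <= 2]. *)
Lemma ideal_enthalpy_sqr : Gam <= 2 -> p ^+ 2 * (1 - cs ^+ 2) <=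
  cs ^+ 2 * (rho ^+ 2 * h p rho ^+ 2 - rho ^+ 2 - 2 * p * rho * h p rho).
Proof.
move=> Gam2; have g0 : 0 < Gam - 1 by rewrite subr_gt0.
pose m := (Gam - 1)^-1.
have m1 : 1 <= m by rewrite invf_ge1 // lerBlDr.
have GE : Gam = 1 + m^-1 by rewrite invrK addrC subrK.
have mN : m != 0 by rewrite invr_neq0 // lt0r_neq0.
have := ideal_sound_speed; pose P := rho * h p rho.
rewrite -/P => cP.
have PE : P = rho + (1 + m) * p.
  rewrite /P iP // GE.
  have -> : 1 + m^-1 - 1 = m^-1 by ring.
  by field; rewrite mN (lt0r_neq0 r0).
have P0 : 0 < P by rewrite mulr_gt0 // enthalpy_gt0.
have mP0 : 0 < m * P by rewrite mulr_gt0 //; lra.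
rewrite -subr_ge0 -(pmulr_rge0 _ mP0).
have cmP : cs ^+ 2 * P * m = (m + 1) * p by rewrite cP GE; field.
have -> : m * P * (cs ^+ 2 *
   (rho ^+ 2 * h p rho ^+ 2 - rho ^+ 2 - 2 * p * rho * h p rho) -
   p ^+ 2 * (1 - cs ^+ 2)) =
  cs ^+ 2 * P * m * (P ^+ 2 - rho ^+ 2 - 2 * p * P)
   - p ^+ 2 * (m * P - cs ^+ 2 * P * m) by rewrite /P; ring.
rewrite cmP PE.
have -> : (m + 1) * p * ((rho + (1 + m) * p) ^+ 2 - rho ^+ 2 -
    2 * p * (rho + (1 + m) * p)) -
    p ^+ 2 * (m * (rho + (1 + m) * p) - (m + 1) * p) =
  p ^+ 2 * (rho * (m * (2 * m + 1)) + p * ((m + 1) * m * (m - 1))) by ring.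
rewrite mulr_ge0 ?sqr_ge0 // addr_ge0 // mulr_ge0 ?(ltW p0) ?(ltW r0) //.
  by rewrite mulr_ge0; lra.
by rewrite !mulr_ge0; lra.
Qed.

End IdealEOS.

Section IdealCore.
Variables (R : realType) (e : R -> R -> R) (gam : 'M[R]_3).
Hypotheses (gamP : is_metric gam) (eP : is_eos e).
Local Notation dot := (codot gam).
Variables (rho p : R) (v : 'rV[R]_3).
Hypothesis WP : is_prim gam (rho, v, p).
Local Notation U := (conservative e gam (rho, v, p)).
Local Notation cs := (sound_speed e p rho).
Local Notation w := (lorentz gam v).

(** Multiplication by [c2 (1 - dot v v)] clears [w^2]. The first term is then at least
    [(1 - |V|)^2 p^2 (1 - c2)] by [ideal_enthalpy_sqr], and the second at least
    [p^2 c2 (1 - dot v v) (1 - z2)], both uniformly in [t]. That their sum is positive is the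
    inequality of [acoustic_lt1]. *)
Lemma admissible_flux_ideal (Gam : R) (zeta : 'rV[R]_3) : 1 < Gam -> Gam <= 2 ->
  is_ideal_eos Gam e ->
  acoustic cs (dot v v) (dot zeta v) (dot zeta zeta) < 1 ->
  admissible gam (U + relative_flux e gam (rho, v, p) zeta).
Proof.
move=> G1 G2 iP; have [r0 p0] := WP; rewrite speed_lt1 // => v1.
have [c0 c1] := sound_speed_sqr_bounds eP p0 r0.
have z0 := codot_ge0 gamP zeta.
have CS := codot_CauchySchwarz gamP zeta v; rewrite mulrC in CS.
move=> /(acoustic_lt1 c0 c1 v1 z0 CS)[V1 K].
apply: admissible_flux => // t /andP[t0 t1].
have X := ideal_enthalpy_sqr eP G1 iP p0 r0 G2.
have w2 := lorentz_sqr gamP v1.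
set X' := _ - _ - _ in X *; set c2 := cs ^+ 2 in c1 K X *.
have c20 : 0 < c2 by rewrite exprn_gt0.
set V := dot zeta v in CS V1 K *; set z2 := dot zeta zeta in z0 CS K *.
have vp : 0 < 1 - dot v v by rewrite subr_gt0.
have cvp : 0 < c2 * (1 - dot v v) by rewrite mulr_gt0.
rewrite -(pmulr_rgt0 _ cvp).
have -> : c2 * (1 - dot v v) * ((1 + t * V) ^+ 2 * w ^+ 2 * X' +
    p ^+ 2 * (1 - t ^+ 2 * z2)) =
  (1 + t * V) ^+ 2 * (c2 * X') + p ^+ 2 * (c2 * (1 - dot v v) * (1 - t ^+ 2 * z2)).
  by rewrite w2; field; exact: lt0r_neq0.
have A1 : (1 - `|V|) ^+ 2 <= (1 + t * V) ^+ 2.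
  have a1 : 1 - `|V| <= 1 + t * V.
    have : `|t * V| <= `|V| by rewrite normrM (ger0_norm t0) ler_piMl.
    by rewrite ler_norml => /andP[]; lra.
  by rewrite ler_sqr // nnegrE ?(le_trans _ a1) // subr_ge0 ltW.
have A2 : (1 - `|V|) ^+ 2 * (p ^+ 2 * (1 - c2)) <= (1 + t * V) ^+ 2 * (c2 * X').
  by apply: ler_pM => //; rewrite ?sqr_ge0 // mulr_ge0 ?sqr_ge0 // subr_ge0 ltW.
have A3 : c2 * (1 - dot v v) * (1 - z2) <= c2 * (1 - dot v v) * (1 - t ^+ 2 * z2).
  by rewrite ler_pM2l // lerD2l lerN2 ler_piMl // expr_le1.
have A4 : 0 < p ^+ 2 * ((1 - c2) * (1 - `|V|) ^+ 2 + c2 * (1 - dot v v) * (1 - z2)).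
  by rewrite mulr_gt0 ?exprn_gt0 //; lra.
have A5 : p ^+ 2 * (c2 * (1 - dot v v) * (1 - z2)) <=
  p ^+ 2 * (c2 * (1 - dot v v) * (1 - t ^+ 2 * z2)).
  by rewrite ler_wpM2l ?sqr_ge0.
lra.
Qed.

End IdealCore.

(** * Boundary states, reduction to zero shift and scaling of the direction *)

Lemma closure_inv_scale (R : realType) (n : nat) (A : set 'rV[R]_n)
    (u x : 'rV[R]_n) (r : R) :
  0 < r -> (forall eta, r < eta -> A (u + eta^-1 *: x)) ->
  closure A (u + r^-1 *: x).
Proof.
move=> r0 H B Bn.
have c : eta^-1 @[eta --> r^'+] --> r^-1.
  apply: cvg_at_right_filter; apply: cvgV; [exact: lt0r_neq0|exact: cvg_id].
have {}c : u + eta^-1 *: x @[eta --> r^'+] --> u + r^-1 *: x.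
  by apply: cvgD; [exact: cvg_cst|apply: cvgZr_tmp].
have Beta : \forall eta \near r^'+, B (u + eta^-1 *: x) by exact: c.
near r^'+ => eta; exists (u + eta^-1 *: x); split; last by near: eta.
by apply: H; near: eta; exact: nbhs_right_gt.
Unshelve. all: by end_near. Qed.

Section Splitting.
Variables (R : realType) (gam : 'M[R]_3).
Hypothesis gamP : is_metric gam.

(* [U + t F = (1 - t b) (U + t / (1 - t b) G)] when [F = G - b U]. *)
Lemma relative_splitting (U G : state R) (S b eta : R) :
  0 < S -> (forall t, `|t| * S < 1 -> admissible gam (U + t *: G)) ->
  S + `|b| < eta ->
  admissible gam (U + eta^-1 *: (G - b *: U)) /\
  admissible gam (U - eta^-1 *: (G - b *: U)).
Proof.
move=> S0 H Se.
have eta0 : 0 < eta by have := normr_ge0 b; lra.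
(* Both signs are covered at once, as [t = eta^-1] and [t = - eta^-1]. *)
suff K t : `|t| * eta <= 1 -> admissible gam (U + t *: (G - b *: U)).
  split; [|rewrite -scaleNr]; apply: K.
    by rewrite gtr0_norm ?invr_gt0 // mulVf // lt0r_neq0.
  by rewrite normrN gtr0_norm ?invr_gt0 // mulVf // lt0r_neq0.
move=> te.
have tb : `|t| * (S + `|b|) < 1.
  have [->|t0] := eqVneq t 0; first by rewrite normr0 mul0r.
  by apply: lt_le_trans te; rewrite ltr_pM2l ?normr_gt0.
have tb1 : t * b <= `|t| * `|b| by rewrite -normrM ler_norm.
have tS : 0 <= `|t| * S by rewrite mulr_ge0 // ltW.
rewrite mulrDr in tb.
have k0 : 0 < 1 - t * b by lra.
have -> : U + t *: (G - b *: U) = (1 - t * b) *: (U + (t / (1 - t * b)) *: G).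
  rewrite [RHS]scalerDr [in RHS]scalerA [_ * (t / _)]mulrC mulfVK ?lt0r_neq0 //.
  by rewrite scalerBr scalerBl scale1r !scalerA addrA addrAC.
apply: admissible_scale => //; apply: H.
rewrite normrM normfV (gtr0_norm k0) mulrAC ltr_pdivrMr // mul1r; lra.
Qed.

End Splitting.

Section RhoIdeal.
Variables (R : realType) (e : R -> R -> R) (gam : 'M[R]_3).
Hypotheses (gamP : is_metric gam) (eP : is_eos e).
Local Notation dot := (codot gam).

Lemma relative_fluxZ W t (xi : 'rV[R]_3) :
  relative_flux e gam W (t *: xi) = t *: relative_flux e gam W xi.
Proof.
case: W => [[rho v] p]; rewrite /relative_flux codotZl // mkstateZ.
congr (mkstate _ _ _); [ring| |ring].
by rewrite scalerDr !scalerA (mulrC p).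
Qed.

Lemma rho_idealE (alpha : R) (beta xi : 'rV[R]_3) rho v p :
  is_prim gam (rho, v, p) ->
  rho_ideal e alpha beta gam xi (conservative e gam (rho, v, p)) =
  acoustic (sound_speed e p rho) (dot v v) (dot xi v) (dot xi xi)
  + `|pairing xi beta| / alpha.
Proof.
move=> WP; rewrite /rho_ideal primitiveK // /acoustic /lorentz invrK.
by rewrite speed_sqr.
Qed.

End RhoIdeal.

(** * Tangents of the conservative variables and fluxes *)

Section CurveDerivatives.
Variables (R : realType).

Lemma is_derive_mkstate (D E : R -> R) (m : R -> 'rV[R]_3) (t dD dE : R)
    (dm : 'rV[R]_3) :
  is_derive t 1 D dD -> (forall i, is_derive t 1 (fun s => m s 0 i) (dm 0 i)) ->
  is_derive t 1 E dE ->
  is_derive t 1 (fun s => mkstate (D s) (m s) (E s)) (mkstate dD dm dE).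
Proof.
move=> Dd md Ed.
have H i j : is_derive t 1 (fun s => mkstate (D s) (m s) (E s) i j)
    (mkstate dD dm dE i j).
  rewrite (ord1 i) /mkstate.
  case: (split_ordP j) => j1 ->.
    rewrite (ord1 j1) row_mxEl mxE eqxx mulr1n.
    have -> : (fun s => row_mx (D s)%:M (row_mx (m s) (E s)%:M) 0 (lshift (3 + 1) 0)) = D.
      by apply/funext => s; rewrite row_mxEl mxE eqxx mulr1n.
    done.
  rewrite row_mxEr.
  case: (split_ordP j1) => j2 ->.
    rewrite row_mxEl.
    have -> : (fun s => row_mx (D s)%:M (row_mx (m s) (E s)%:M) 0
       (rshift 1 (lshift 1 j2))) = (fun s => m s 0 j2).
      by apply/funext => s; rewrite row_mxEr row_mxEl.
    done.
  rewrite (ord1 j2) row_mxEr mxE eqxx mulr1n.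
  have -> : (fun s => row_mx (D s)%:M (row_mx (m s) (E s)%:M) 0
       (rshift 1 (rshift 3 0))) = E.
    by apply/funext => s; rewrite row_mxEr row_mxEr mxE eqxx mulr1n.
  done.
have d : derivable (fun s => mkstate (D s) (m s) (E s)) t 1.
  by apply/derivable_mxP => i j; exact: (ex_derive (is_derive := H i j)).
split=> //; rewrite derive_mx //; apply/matrixP => i j.
by rewrite mxE (derive_val (is_derive := H i j)).
Qed.

End CurveDerivatives.

Lemma is_derive_diff_comp (R : realType) (V W : normedModType R)
    (F : V -> W) (C : R -> V) (t : R) (dC : V) :
  is_derive t 1 C dC -> differentiable F (C t) ->
  is_derive t 1 (F \o C) ('d F (C t) dC).
Proof.
move=> [/derivable1_diffP Cd <-] Fd.
have FCd : differentiable (F \o C) t by exact: differentiable_comp Cd Fd.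
split; first exact/derivable1_diffP.
rewrite (@deriveE _ _ _ _ t 1 FCd) (@deriveE _ _ _ _ t 1 Cd).
by rewrite (diff_comp Cd Fd).
Qed.

Section Tangents.
Variables (R : realType) (e : R -> R -> R) (gam : 'M[R]_3).
Hypotheses (gamP : is_metric gam) (eP : is_eos e).
Local Notation h := (enthalpy e).
Local Notation dot := (codot gam).
Local Notation w := (lorentz gam).

Section Formulas.
Variables (rho p : R) (v xi : 'rV[R]_3).
Local Notation q := (rho * h p rho * w v ^+ 2).

(* Derivatives of [D], [q = rho h w^2], [conservative] and [relative_flux]
   along [(a, u, c)], given the derivative [dh] of the enthalpy. *)
Definition tangent_D (a : R) (u : 'rV[R]_3) : R :=
  a * w v + rho * (w v ^+ 3 * dot v u).

Definition tangent_q (a : R) (u : 'rV[R]_3) (dh : R) : R :=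
  (a * h p rho + rho * dh) * w v ^+ 2
  + rho * h p rho * (2 * w v ^+ 4 * dot v u).

Definition tangent_U (a : R) (u : 'rV[R]_3) (c dh : R) : state R :=
  mkstate (tangent_D a u) (tangent_q a u dh *: v + q *: u)
    (tangent_q a u dh - c).

Definition tangent_G (a : R) (u : 'rV[R]_3) (c dh : R) : state R :=
  mkstate (tangent_D a u * dot xi v + rho * w v * dot xi u)
    (dot xi u *: (q *: v) + dot xi v *: (tangent_q a u dh *: v + q *: u)
     + c *: xi)
    (tangent_q a u dh * dot xi v + q * dot xi u).

Hypothesis WP : is_prim gam (rho, v, p).
Variables (a c dh : R) (u : 'rV[R]_3).
Hypothesis hd : is_derive (0 : R) 1 (fun t => h (p + t * c) (rho + t * a)) dh.

Definition prim_curve (t : R) : R * 'rV[R]_3 * R :=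
  (rho + t * a, v + t *: u, p + t * c).

Let vv1 : dot v v < 1. Proof. by case: WP => _ _; rewrite speed_lt1. Qed.

Let dvv t : dot (v + t *: u) (v + t *: u) = dot v v + t * (2 * dot v u) + t ^+ 2 * dot u u.
Proof.
by rewrite !(codotDl, codotDr, codotZl, codotZr) // (codotC gamP u v); ring.
Qed.

Local Notation affd x y := (is_derive1_affine x y 0).

Let dvvd : is_derive (0 : R) 1 (fun t => dot (v + t *: u) (v + t *: u)) (2 * dot v u).
Proof.
have -> : (fun t => dot (v + t *: u) (v + t *: u)) =
   (fun t => dot v v + t * (2 * dot v u + t * dot u u)).
  by apply/funext => t; rewrite dvv; ring.
have := is_derive1_mul (is_derive_id (0 : R) 1) (affd (2 * dot v u) (dot u u)).
move=> H; apply: is_derive_eq; rewrite /=; ring.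
Qed.

Let lorentzd : is_derive (0 : R) 1 (fun t => w (v + t *: u)) (w v ^+ 3 * dot v u).
Proof.
have pos : 0 < 1 - dot (v + 0 *: u) (v + 0 *: u).
  by rewrite scale0r addr0 subr_gt0.
have -> : (fun t => w (v + t *: u)) =
   (fun t => (Num.sqrt (1 - dot (v + t *: u) (v + t *: u)))^-1).
  by apply/funext => t; rewrite /lorentz speed_sqr.
have d1 : is_derive (0 : R) 1 (fun t => 1 - dot (v + t *: u) (v + t *: u)) (- (2 * dot v u)).
  by rewrite -[X in is_derive _ _ _ X]sub0r; exact: is_deriveB (is_derive_cst (1 : R) (0 : R) 1) dvvd.
have d2 := is_derive1_sqrt_comp d1 pos.
have sN : Num.sqrt (1 - dot (v + 0 *: u) (v + 0 *: u)) != 0.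
  by rewrite lt0r_neq0 // sqrtr_gt0.
have := is_derive1V d2 sN.
move: sN; rewrite scale0r addr0.
have -> : Num.sqrt (1 - dot v v) = (w v)^-1 by rewrite /lorentz invrK speed_sqr.
move=> wN H; apply: is_derive_eq; field.
by rewrite invr_eq0 in wN.
Qed.

Let curve0 : prim_curve 0 = (rho, v, p).
Proof. by rewrite /prim_curve !mul0r scale0r !addr0. Qed.

Let Dd : is_derive (0 : R) 1 (fun t => (rho + t * a) * w (v + t *: u)) (tangent_D a u).
Proof.
have := is_derive1_mul (affd rho a) lorentzd; rewrite mul0r scale0r !addr0.
by move=> H; apply: is_derive_eq.
Qed.

Let qd : is_derive (0 : R) 1 (fun t => (rho + t * a) * h (p + t * c) (rho + t * a)
   * w (v + t *: u) ^+ 2) (tangent_q a u dh).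
Proof.
have := is_derive1_mul (is_derive1_mul (affd rho a) hd) (is_derive1_sqr lorentzd).
rewrite !mul0r scale0r !addr0 => H; apply: is_derive_eq.
by rewrite /tangent_q; ring.
Qed.

Let Ed : is_derive (0 : R) 1 (fun t => (rho + t * a) * h (p + t * c) (rho + t * a)
   * w (v + t *: u) ^+ 2 - (p + t * c)) (tangent_q a u dh - c).
Proof. exact: is_deriveB qd (affd p c). Qed.

Let md i : is_derive (0 : R) 1 (fun t => (((rho + t * a) * h (p + t * c) (rho + t * a)
   * w (v + t *: u) ^+ 2) *: (v + t *: u)) 0 i)
  ((tangent_q a u dh *: v + q *: u) 0 i).
Proof.
have -> : (fun s : R => (((rho + s * a) * h (p + s * c) (rho + s * a) *
     w (v + s *: u) ^+ 2) *: (v + s *: u)) 0 i) =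
   (fun s : R => ((rho + s * a) * h (p + s * c) (rho + s * a) *
     w (v + s *: u) ^+ 2) * (v 0 i + s * u 0 i)).
  by apply/funext => s; rewrite !mxE.
have := is_derive1_mul qd (affd (v 0 i) (u 0 i)).
by rewrite !mul0r scale0r !addr0 => H; apply: is_derive_eq; rewrite !mxE.
Qed.

Lemma is_derive_conservative :
  is_derive (0 : R) 1 (fun t => conservative e gam (prim_curve t)) (tangent_U a u c dh).
Proof. exact: (is_derive_mkstate Dd md Ed). Qed.

Let Vd : is_derive (0 : R) 1 (fun t => dot xi (v + t *: u)) (dot xi u).
Proof.
have -> : (fun t => dot xi (v + t *: u)) = (fun t => dot xi v + t * dot xi u).
  by apply/funext => t; rewrite codotDr // codotZr.
exact: is_derive1_affine.
Qed.

Let DVd : is_derive (0 : R) 1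
  (fun t => (rho + t * a) * w (v + t *: u) * dot xi (v + t *: u))
  (tangent_D a u * dot xi v + rho * w v * dot xi u).
Proof.
have := is_derive1_mul Dd Vd; rewrite mul0r scale0r !addr0.
by move=> H; apply: is_derive_eq.
Qed.

Let qVd : is_derive (0 : R) 1
  (fun t => (rho + t * a) * h (p + t * c) (rho + t * a) * w (v + t *: u) ^+ 2
     * dot xi (v + t *: u))
  (tangent_q a u dh * dot xi v + q * dot xi u).
Proof.
have := is_derive1_mul qd Vd; rewrite !mul0r scale0r !addr0.
by move=> H; apply: is_derive_eq.
Qed.

Let mVd i : is_derive (0 : R) 1
  (fun s => (dot xi (v + s *: u) *: (((rho + s * a) *
       h (p + s * c) (rho + s * a) * w (v + s *: u) ^+ 2) *: (v + s *: u))
       + (p + s * c) *: xi) 0 i)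
  ((dot xi u *: (q *: v) + dot xi v *: (tangent_q a u dh *: v + q *: u)
     + c *: xi) 0 i).
Proof.
have -> : (fun s : R => (dot xi (v + s *: u) *: (((rho + s * a) *
       h (p + s * c) (rho + s * a) * w (v + s *: u) ^+ 2) *: (v + s *: u))
       + (p + s * c) *: xi) 0 i) =
     (fun s : R => dot xi (v + s *: u) * (((rho + s * a) *
        h (p + s * c) (rho + s * a) * w (v + s *: u) ^+ 2) * (v 0 i + s * u 0 i))
        + (p + s * c) * xi 0 i).
  by apply/funext => s; rewrite !mxE.
have H1 := is_derive1_mul Vd (is_derive1_mul qd (affd (v 0 i) (u 0 i))).
have H2 := is_derive1_mul (affd p c) (is_derive_cst (xi 0 i) (0 : R) 1).
have := is_deriveD H1 H2; rewrite !mul0r scale0r !addr0 => H.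
by apply: is_derive_eq; rewrite !mxE /=; ring.
Qed.

Lemma is_derive_relative_flux :
  is_derive (0 : R) 1 (fun t => relative_flux e gam (prim_curve t) xi) (tangent_G a u c dh).
Proof. exact: (is_derive_mkstate DVd mVd qVd). Qed.

(** [dir_flux_conservative] applies to primitive triples only. Their set is open, and the derivative
    at [0] depends on the curve near [0] alone. *)
Lemma prim_curve_near : \forall t \near (0 : R), is_prim gam (prim_curve t).
Proof.
case: (WP) => r0 p0 _.
have cont (x y : R) : 0 < x -> \forall t \near (0 : R), 0 < x + t * y.
  move=> x0.
  have cx : {for (0 : R), continuous (fun t : R => x + t * y)}.
    apply/differentiable_continuous/derivable1_diffP.
    exact: (ex_derive (is_derive := affd x y)).
  by move: cx => /cvgr_gt; apply; rewrite mul0r addr0.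
have cv : {for (0 : R), continuous (fun t : R => dot (v + t *: u) (v + t *: u))}.
  apply/differentiable_continuous/derivable1_diffP.
  exact: (ex_derive (is_derive := dvvd)).
have vn : \forall t \near (0 : R), dot (v + t *: u) (v + t *: u) < 1.
  by move: cv => /cvgr_lt; apply; rewrite scale0r addr0.
near=> t; split; rewrite ?speed_lt1 //; near: t => //; exact: cont.
Unshelve. all: by end_near. Qed.

(* [F] is explicit along the curve because [primitive] inverts
   [conservative]. *)
Lemma dir_flux_tangent (alpha : R) (beta : 'rV[R]_3) :
  differentiable (dir_flux e alpha beta gam xi) (conservative e gam (rho, v, p)) ->
  'd (dir_flux e alpha beta gam xi) (conservative e gam (rho, v, p))
    (tangent_U a u c dh) =
  tangent_G a u c dh - (pairing xi beta / alpha) *: tangent_U a u c dh.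
Proof.
set F := dir_flux _ _ _ _ _; set b := _ / alpha => Fd.
pose C (t : R) := conservative e gam (prim_curve t).
have C0 : C 0 = conservative e gam (rho, v, p) by rewrite /C curve0.
have Cd := is_derive_conservative.
have Fd0 : differentiable F (C 0) by rewrite C0.
have FCd := is_derive_diff_comp Cd Fd0.
rewrite -C0 -(derive_val (is_derive := FCd)).
have E : \forall t \near (0 : R), (F \o C) t =
    relative_flux e gam (prim_curve t) xi - b *: C t.
  near=> t; apply: dir_flux_conservative => //.
  by near: t; exact: prim_curve_near.
rewrite (near_eq_derive _ E).
have bCd := is_deriveZ b Cd.
exact: (derive_val (is_derive := is_deriveB is_derive_relative_flux bCd)).
Unshelve. all: by end_near. Qed.

End Formulas.
End Tangents.

(** * Eigenvalues of the Jacobian *)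

(* The perturbation [(drho, dv, dp)] enters through [drho], [dp],
   [al = v^j dv_j] and [be = xi^j dv_j]; [X = V - mu]. *)
Lemma characteristic_algebra (F : fieldType)
    (rho h w hr hp c2 V vv zz mu drho dp al be : F) :
  let X := V - mu in
  let q := rho * h * w ^+ 2 in
  let dq := (drho * h + rho * (hr * drho + hp * dp)) * w ^+ 2
    + rho * h * (2 * w ^+ 4 * al) in
  rho != 0 -> h != 0 -> w != 0 -> c2 != 0 -> rho^-1 - hp != 0 ->
  vv = 1 - (w ^+ 2)^-1 -> hr = c2 * h * (rho^-1 - hp) -> X != 0 ->
  rho * w * be + X * (drho * w + rho * (w ^+ 3 * al)) = 0 ->
  X * dq + q * be + mu * dp = 0 ->
  X * q * be + (zz - mu * V) * dp = 0 ->
  X * q * al + (V - mu * vv) * dp = 0 ->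
  (1 - vv * c2) * mu ^+ 2 - 2 * V * (1 - c2) * mu + (1 - c2) * V ^+ 2
    - c2 * (1 - vv) * zz != 0 ->
  drho = 0 /\ dp = 0.
Proof.
move=> X q dq rN hN wN cN aN vvE hrE XN e1 e3 f1 f2 QN.
have qN : q != 0 by rewrite !mulf_neq0 ?expf_neq0.
(* This combination of the energy, mass and [v]-momentum equations eliminates [al] and [be]. It says
   that away from the material speed the perturbation is isentropic, [dh = dp / rho]. *)
have entropy : X * (hr * drho + hp * dp - dp / rho) = 0.
  transitivity (h * ((X * dq + q * be + mu * dp) / q
    - (rho * w * be + X * (drho * w + rho * (w ^+ 3 * al))) / (rho * w)
    - (X * q * al + (V - mu * vv) * dp) * w ^+ 2 / q)).
    by rewrite /dq /q /X vvE; field; rewrite rN hN wN.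
  by rewrite e1 e3 f2 !mul0r !subr0 mulr0.
have dpE : dp = c2 * h * drho.
  move/eqP: entropy; rewrite mulf_eq0 (negPf XN) /= => /eqP entropy.
  apply: (mulfI aN).
  have -> : (rho^-1 - hp) * (c2 * h * drho) = hr * drho by rewrite hrE; ring.
  by apply/eqP; rewrite eq_sym -subr_eq0 -entropy; apply/eqP; ring.
suff dp0 : dp = 0.
  split=> //; move/eqP: dpE; rewrite dp0 eq_sym !mulf_eq0 (negPf cN) (negPf hN) /=.
  by move/eqP.
apply/eqP; move: QN; apply: contraNT => dpN.
have : dp * ((1 - vv * c2) * mu ^+ 2 - 2 * V * (1 - c2) * mu + (1 - c2) * V ^+ 2
    - c2 * (1 - vv) * zz) = 0; last first.
  by move/eqP; rewrite mulf_eq0 (negPf dpN).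
(* The mass equation and the two contracted momentum equations, weighted so that [al] and [be]
   cancel; what is left is [dp] times the acoustic quadratic. *)
transitivity ((1 - vv) * (c2 * h * w * X
    * (rho * w * be + X * (drho * w + rho * (w ^+ 3 * al)))
    - c2 * (X * q * be + (zz - mu * V) * dp)
    - X * c2 * w ^+ 2 * (X * q * al + (V - mu * vv) * dp))).
  by rewrite dpE /q /X vvE; field; rewrite wN.
by rewrite e1 f1 f2 !mulr0 !subr0 mulr0.
Qed.

Section Spectrum.
Variables (R : realType) (e : R -> R -> R) (gam : 'M[R]_3).
Hypotheses (gamP : is_metric gam) (eP : is_eos e).
Local Notation h := (enthalpy e).
Local Notation dot := (codot gam).
Local Notation w := (lorentz gam).
Local Notation C := (complex R).
Local Notation P := (real_complex R).

Variables (rho p : R) (v xi : 'rV[R]_3).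
Hypothesis WP : is_prim gam (rho, v, p).
Local Notation q := (rho * h p rho * w v ^+ 2).
Local Notation hr := (drho h p rho).
Local Notation hp := (dp h p rho).
Local Notation U := (conservative e gam (rho, v, p)).

(* The rows are the values of [f] on the basis of primitive perturbations. *)
Definition tangent_mx (f : R -> 'rV[R]_3 -> R -> R -> state R)
    : 'M[R]_(1 + (3 + 1)) :=
  col_mx (f 1 0 0 hr)
    (col_mx (\matrix_(i < 3) f 0 (delta_mx 0 i) 0 0) (f 0 0 1 hp)).

Local Notation MU := (tangent_mx (tangent_U e gam rho p v)).
Local Notation MG := (tangent_mx (tangent_G e gam rho p v xi)).

Lemma tangent_mx_jacobian (alpha : R) (beta : 'rV[R]_3) :
  let F := dir_flux e alpha beta gam xi in
  differentiable F U ->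
  MU *m jacobian F U = MG - (pairing xi beta / alpha) *: MU.
Proof.
case: (WP) => r0 p0 _ F Fd.
have tan a u c dh :
    is_derive (0 : R) 1 (fun t => h (p + t * c) (rho + t * a)) dh ->
    tangent_U e gam rho p v a u c dh *m jacobian F U =
    tangent_G e gam rho p v xi a u c dh
      - (pairing xi beta / alpha) *: tangent_U e gam rho p v a u c dh.
  move=> hd; rewrite /jacobian mul_rV_lin1.
  exact: (dir_flux_tangent gamP eP WP u hd Fd).
have affd x y := @is_derive1_affine R x y 0.
(* The enthalpy derivative along the three kinds of basis directions is [hr] for the density, [0]
   for the velocity and [hp] for the pressure. *)
have d1 : is_derive (0 : R) 1 (fun t => h (p + t * 0) (rho + t * 1)) hr.
  have hd : is_derive (rho + 0 * 1) 1 (h p) hr.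
    rewrite mul0r addr0 /drho derive1E; apply: derivableP.
    exact: (ex_derive (is_derive := is_derive_enthalpy_rho eP p0 r0)).
  have -> : (fun t => h (p + t * 0) (rho + t * 1)) = h p \o (fun t => rho + t * 1).
    by apply/funext => t /=; rewrite mulr0 addr0.
  by rewrite -[hr]mulr1; exact: (@is_derive1_comp _ (h p)).
have d2 : is_derive (0 : R) 1 (fun t => h (p + t * 0) (rho + t * 0)) 0.
  have -> : (fun t => h (p + t * 0) (rho + t * 0)) = cst (h p rho).
    by apply/funext => t /=; rewrite !mulr0 !addr0.
  exact: is_derive_cst.
have d3 : is_derive (0 : R) 1 (fun t => h (p + t * 1) (rho + t * 0)) hp.
  have hd : is_derive (p + 0 * 1) 1 (fun q => h q rho) hp.
    rewrite mul0r addr0 /dp derive1E; apply: derivableP.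
    exact: (ex_derive (is_derive := is_derive_enthalpy_p eP p0 r0)).
  have -> : (fun t => h (p + t * 1) (rho + t * 0)) = (fun q => h q rho) \o (fun t => p + t * 1).
    by apply/funext => t /=; rewrite mulr0 addr0.
  by rewrite -[hp]mulr1; exact: (@is_derive1_comp _ (fun q => h q rho)).
rewrite /tangent_mx !mul_col_mx !scale_col_mx !opp_col_mx !add_col_mx.
rewrite (tan _ _ _ _ d1) (tan _ _ _ _ d3); congr (col_mx _ (col_mx _ _)).
apply/row_matrixP => i.
have rowB m n (A B : 'M[R]_(m, n)) k b : row k (A - b *: B) = row k A - b *: row k B.
  by apply/rowP => j; rewrite !mxE.
by rewrite row_mul rowB !rowK (tan _ _ _ _ d2).
Qed.

Lemma mkstate_D D (m : 'rV[R]_3) E : mkstate D m E 0 (lshift (3 + 1) 0) = D.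
Proof. by rewrite /mkstate row_mxEl mxE eqxx mulr1n. Qed.

Lemma mkstate_m D (m : 'rV[R]_3) E j :
  mkstate D m E 0 (rshift 1 (lshift 1 j)) = m 0 j.
Proof. by rewrite /mkstate row_mxEr row_mxEl. Qed.

Lemma mkstate_E D (m : 'rV[R]_3) E : mkstate D m E 0 (rshift 1 (rshift 3 0)) = E.
Proof. by rewrite /mkstate !row_mxEr mxE eqxx mulr1n. Qed.

Section Kernel.
Variables (y0 yp : C) (yv : 'rV[C]_3).
Local Notation Y := (row_mx y0%:M (row_mx yv yp%:M) : 'rV[C]_(1 + (3 + 1))).

Lemma mul_tangent_mx f j : (Y *m map_mx P (tangent_mx f)) 0 j =
  y0 * P (f 1 0 0 hr 0 j) + \sum_(i < 3) yv 0 i * P (f 0 (delta_mx 0 i) 0 0 0 j)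
  + yp * P (f 0 0 1 hp 0 j).
Proof.
rewrite /tangent_mx !map_col_mx !mul_row_col !mul_scalar_mx !mxE addrA.
congr (_ + _ + _); apply: eq_bigr => i _.
by rewrite !mxE.
Qed.

(** [Y] is a complex perturbation [(drho, dv, dp)], and [al] and [be] are its contractions
    [v^j dv_j] and [xi^j dv_j]. *)
Let al : C := \sum_(i < 3) yv 0 i * P (dot v (delta_mx 0 i)).
Let be : C := \sum_(i < 3) yv 0 i * P (dot xi (delta_mx 0 i)).

(** Each entry of [tangent_U] and [tangent_G] depends on [u] only through [dot v u], [dot xi u] and
    one component of [u], so contraction with [yv] leaves [al], [be] and one component of [yv]. *)
Lemma sum_dual (A B K : R) (k : 'I_3) (g : 'I_3 -> R) :
  (forall i, g i = A * dot v (delta_mx 0 i) + B * dot xi (delta_mx 0 i)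
     + K * (i == k)%:R) ->
  \sum_(i < 3) yv 0 i * P (g i) = P A * al + P B * be + P K * yv 0 k.
Proof.
move=> gE; rewrite /al /be !big_ord_recl !big_ord0 !gE !rmorphD !rmorphM /=.
have kE : P K * yv 0 k = P K * (yv 0 ord0 * P (ord0 == k)%:R
    + yv 0 (lift ord0 ord0) * P (lift ord0 ord0 == k)%:R
    + yv 0 (lift ord0 (lift ord0 ord0)) * P (lift ord0 (lift ord0 ord0) == k)%:R).
  by case: k {gE} => -[|[|[|//]]] Hk; rewrite ?rmorph0 ?rmorph1 ?mulr0 ?mulr1 ?addr0 ?add0r;
    congr (_ * yv _ _); exact: val_inj.
rewrite kE; ring.
Qed.

Let dot0 a : dot a 0 = 0.
Proof. by rewrite -(scale0r (0 : 'rV_3)) codotZr // mul0r. Qed.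

Lemma mul_tangent_mx_dual (f : R -> 'rV[R]_3 -> R -> R -> state R) j
    (A B K gr gp : R) (k : 'I_3) :
  f 1 0 0 hr 0 j = gr -> f 0 0 1 hp 0 j = gp ->
  (forall i, f 0 (delta_mx 0 i) 0 0 0 j =
     A * dot v (delta_mx 0 i) + B * dot xi (delta_mx 0 i) + K * (i == k)%:R) ->
  (Y *m map_mx P (tangent_mx f)) 0 j =
  y0 * P gr + (P A * al + P B * be + P K * yv 0 k) + yp * P gp.
Proof. by move=> <- <- /sum_dual <-; exact: mul_tangent_mx. Qed.

(** [DD] and [DQ] are the derivatives of [D] and of [q = rho h w^2] along [Y]. *)
Let DD := y0 * P (w v) + P (rho * w v ^+ 3) * al.
Let DQ := y0 * P ((h p rho + rho * hr) * w v ^+ 2)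
  + P (rho * h p rho * (2 * w v ^+ 4)) * al + yp * P (rho * hp * w v ^+ 2).

Let tangent_D1 : tangent_D gam rho v 1 0 = w v.
Proof. by rewrite /tangent_D dot0; ring. Qed.

Let tangent_D0 : tangent_D gam rho v 0 0 = 0.
Proof. by rewrite /tangent_D dot0; ring. Qed.

Let tangent_q1 : tangent_q e gam rho p v 1 0 hr = (h p rho + rho * hr) * w v ^+ 2.
Proof. by rewrite /tangent_q dot0; ring. Qed.

Let tangent_q0 : tangent_q e gam rho p v 0 0 hp = rho * hp * w v ^+ 2.
Proof. by rewrite /tangent_q dot0; ring. Qed.

Let U_D : (Y *m map_mx P MU) 0 (lshift (3 + 1) 0) = DD.
Proof.
rewrite (mul_tangent_mx_dual (A := rho * w v ^+ 3) (B := 0) (K := 0) (k := 0)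
  (mkstate_D _ _ _) (mkstate_D _ _ _)).
  by rewrite tangent_D1 tangent_D0 /DD !rmorph0; ring.
by move=> i; apply: etrans (mkstate_D _ _ _) _; rewrite /tangent_D; ring.
Qed.

Let G_D : (Y *m map_mx P MG) 0 (lshift (3 + 1) 0) =
  DD * P (dot xi v) + P (rho * w v) * be.
Proof.
rewrite (mul_tangent_mx_dual (A := rho * w v ^+ 3 * dot xi v) (B := rho * w v)
  (K := 0) (k := 0) (mkstate_D _ _ _) (mkstate_D _ _ _)).
  rewrite tangent_D1 tangent_D0 !dot0 /DD; ring.
by move=> i; apply: etrans (mkstate_D _ _ _) _; rewrite /tangent_D; ring.
Qed.

Let U_E : (Y *m map_mx P MU) 0 (rshift 1 (rshift 3 0)) = DQ - yp.
Proof.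
rewrite (mul_tangent_mx_dual (A := rho * h p rho * (2 * w v ^+ 4)) (B := 0)
  (K := 0) (k := 0) (mkstate_E _ _ _) (mkstate_E _ _ _)).
  rewrite tangent_q1 tangent_q0 /DQ; ring.
by move=> i; apply: etrans (mkstate_E _ _ _) _; rewrite /tangent_q; ring.
Qed.

Let G_E : (Y *m map_mx P MG) 0 (rshift 1 (rshift 3 0)) =
  DQ * P (dot xi v) + P q * be.
Proof.
rewrite (mul_tangent_mx_dual (A := rho * h p rho * (2 * w v ^+ 4) * dot xi v)
  (B := q) (K := 0) (k := 0) (mkstate_E _ _ _) (mkstate_E _ _ _)).
  rewrite tangent_q1 tangent_q0 !dot0 /DQ; ring.
by move=> i; apply: etrans (mkstate_E _ _ _) _; rewrite /tangent_q; ring.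
Qed.

Let U_m j : (Y *m map_mx P MU) 0 (rshift 1 (lshift 1 j)) =
  DQ * P (v 0 j) + P q * yv 0 j.
Proof.
rewrite (mul_tangent_mx_dual (A := rho * h p rho * (2 * w v ^+ 4) * v 0 j)
  (B := 0) (K := q) (k := j) (mkstate_m _ _ _ _) (mkstate_m _ _ _ _)).
  rewrite tangent_q1 tangent_q0 !mxE /DQ; ring.
move=> i; apply: etrans (mkstate_m _ _ _ _) _.
by rewrite /tangent_q !mxE eqxx /= eq_sym; ring.
Qed.

Let G_m j : (Y *m map_mx P MG) 0 (rshift 1 (lshift 1 j)) =
  be * P (q * v 0 j) + P (dot xi v) * (DQ * P (v 0 j) + P q * yv 0 j)
  + yp * P (xi 0 j).
Proof.
rewrite (mul_tangent_mx_dual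
  (A := rho * h p rho * (2 * w v ^+ 4) * v 0 j * dot xi v) (B := q * v 0 j)
  (K := q * dot xi v) (k := j) (mkstate_m _ _ _ _) (mkstate_m _ _ _ _)).
  rewrite tangent_q1 tangent_q0 !dot0 !mxE /DQ; ring.
move=> i; apply: etrans (mkstate_m _ _ _ _) _.
by rewrite /tangent_q !mxE eqxx /= eq_sym; ring.
Qed.

(** The mass and energy entries give the first two equations. Subtracting [v_j] times the energy
    equation from the momentum entry [j] cancels [DQ] and [be], leaving only [yv_j] and [yp]. *)
Lemma tangent_kernel mu :
  Y *m (map_mx P MG - mu *: map_mx P MU) = 0 ->
  [/\ P rho * P (w v) * be + (P (dot xi v) - mu)
        * (y0 * P (w v) + P rho * (P (w v) ^+ 3 * al)) = 0,
      (P (dot xi v) - mu) * ((y0 * P (h p rho) + P rho * (P hr * y0 + P hp * yp))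
          * P (w v) ^+ 2 + P rho * P (h p rho) * (2 * P (w v) ^+ 4 * al))
        + P q * be + mu * yp = 0 &
      forall j, (P (dot xi v) - mu) * P q * yv 0 j
        + (P (xi 0 j) - mu * P (v 0 j)) * yp = 0].
Proof.
rewrite mulmxBr -scalemxAr => /eqP; rewrite subr_eq0 => /eqP YE.
have ent j : (Y *m map_mx P MG) 0 j = mu * (Y *m map_mx P MU) 0 j.
  by rewrite YE mxE.
have DQE : DQ = (y0 * P (h p rho) + P rho * (P hr * y0 + P hp * yp))
    * P (w v) ^+ 2 + P rho * P (h p rho) * (2 * P (w v) ^+ 4 * al).
  by rewrite /DQ; ring.
have eD := ent (lshift (3 + 1) 0); have eE := ent (rshift 1 (rshift 3 0)).
rewrite G_D U_D in eD; rewrite G_E U_E in eE.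
have e3 : (P (dot xi v) - mu) * DQ + P q * be + mu * yp = 0.
  have : DQ * P (dot xi v) + P q * be - mu * (DQ - yp) = 0 by rewrite eE subrr.
  by move=> <-; ring.
split.
- have DDE : DD = y0 * P (w v) + P rho * (P (w v) ^+ 3 * al).
    by rewrite /DD; ring.
  have : DD * P (dot xi v) + P (rho * w v) * be - mu * DD = 0 by rewrite eD subrr.
  by rewrite -DDE => <-; ring.
- by rewrite -DQE.
- move=> j; have := ent (rshift 1 (lshift 1 j)); rewrite G_m U_m => em.
  have : be * P (q * v 0 j) + P (dot xi v) * (DQ * P (v 0 j) + P q * yv 0 j)
    + yp * P (xi 0 j) - mu * (DQ * P (v 0 j) + P q * yv 0 j)
    - P (v 0 j) * ((P (dot xi v) - mu) * DQ + P q * be + mu * yp) = 0.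
    by rewrite em e3 mulr0 subr0 subrr.
  by move=> <-; ring.
Qed.

End Kernel.
End Spectrum.

(** * Bound on the spectral radius *)

Lemma kermx_mull_neq0 (F : fieldType) (n : nat) (A B : 'M[F]_n) :
  kermx A != 0 -> kermx (B *m A) != 0.
Proof.
rewrite !kermx_eq0; apply: contraNN; rewrite /row_free => /eqP rk.
by rewrite eqn_leq rank_leq_row /= -{1}rk mxrankM_maxr.
Qed.

(** The differential is chosen by [get]; when no candidate exists it returns [point], the zero
    map. *)
Lemma jacobian_ndiff (R : realType) (n m : nat) (F : 'rV[R]_n -> 'rV[R]_m) U :
  ~ differentiable F U -> jacobian F U = 0.
Proof.
move=> nd; rewrite /jacobian.
have -> : 'd F U = point.
  rewrite /diff; set Q := (X in get X).
  have [ex|nex] := pselect (exists df, Q df).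
    by case: nd; apply/diffP; exact: (getPex ex).
  by apply: getPN => df Qdf; apply: nex; exists df.
by apply/matrixP => i j; rewrite !mxE.
Qed.

Section SpectralRadius.
Variables (R : realType) (e : R -> R -> R) (gam : 'M[R]_3).
Hypotheses (gamP : is_metric gam) (eP : is_eos e).
Local Notation h := (enthalpy e).
Local Notation dot := (codot gam).
Local Notation C := (complex R).
Local Notation P := (real_complex R).

Variables (rho p : R) (v xi : 'rV[R]_3).
Hypothesis WP : is_prim gam (rho, v, p).
Local Notation U := (conservative e gam (rho, v, p)).
Local Notation MU := (tangent_mx e rho p (tangent_U e gam rho p v)).
Local Notation MG := (tangent_mx e rho p (tangent_G e gam rho p v xi)).
Local Notation w := (lorentz gam v).
Local Notation c := (sound_speed e p rho).
Local Notation vv := (dot v v).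
Local Notation V := (dot xi v).
Local Notation zz := (dot xi xi).

Lemma codot_sum_delta a b :
  dot a b = \sum_(i < 3) b 0 i * dot a (delta_mx 0 i).
Proof.
by rewrite {1}(row_sum_delta b) !big_ord_recl !big_ord0 !addr0 !codotDr // !codotZr.
Qed.

Let r0 : 0 < rho. Proof. by case: WP. Qed.
Let p0 : 0 < p. Proof. by case: WP. Qed.
Let vv1 : vv < 1. Proof. by case: WP => _ _; rewrite speed_lt1. Qed.

(** Contracting the momentum equations with [xi^j] and with [v^j] closes the system in [y0], [yp],
    [al] and [be], and [characteristic_algebra] gives [y0 = yp = 0]. The uncontracted equations then
    force [yv = 0]. *)
Lemma tangent_kernel_trivial (mu : C) (Y : 'rV[C]_(1 + (3 + 1))) :
  mu != P V ->
  (1 - P vv * P c ^+ 2) * mu ^+ 2 - 2 * P V * (1 - P c ^+ 2) * mu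
    + (1 - P c ^+ 2) * P V ^+ 2 - P c ^+ 2 * (1 - P vv) * P zz != 0 ->
  Y *m (map_mx P MG - mu *: map_mx P MU) = 0 -> Y = 0.
Proof.
move=> muV Qmu.
pose y0 := lsubmx Y 0 0; pose yv := lsubmx (rsubmx Y); pose yp := rsubmx (rsubmx Y) 0 0.
have -> : Y = row_mx y0%:M (row_mx yv yp%:M).
  by rewrite /y0 /yv /yp -!mx11_scalar !hsubmxK.
move=> /(tangent_kernel gamP)[].
set al := \sum_i _ * P (dot v _); set be := \sum_i _ * P (dot xi _).
move=> eD eE em.
have h0 := enthalpy_gt0 eP p0 r0; have w0 := lorentz_gt0 gamP vv1.
have [c0 c1] := sound_speed_sqr_bounds eP p0 r0.
have PN x : x != 0 -> P x != 0 by rewrite fmorph_eq0.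
have X0 : P V - mu != 0 by rewrite subr_eq0 eq_sym.
pose q := rho * h p rho * w ^+ 2.
have qN : P q != 0 by rewrite PN // !mulf_neq0 ?expf_neq0 // lt0r_neq0.
have f1 : (P V - mu) * P q * be + (P zz - mu * P V) * yp = 0.
  have -> : P zz - mu * P V = \sum_i (P (xi 0 i) - mu * P (v 0 i)) * P (dot xi (delta_mx 0 i)).
    rewrite (codot_sum_delta xi xi) (codot_sum_delta xi v) !raddf_sum mulr_sumr /=.
    by rewrite -sumrB; apply: eq_bigr => i _; ring.
  rewrite /be mulr_sumr mulr_suml -big_split /= big1 // => i _.
  have := em i; rewrite -/q => emi.
  transitivity (P (dot xi (delta_mx 0 i)) * ((P V - mu) * P q * yv 0 i +
     (P (xi 0 i) - mu * P (v 0 i)) * yp)); first by ring.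
  by rewrite emi mulr0.
have f2 : (P V - mu) * P q * al + (P V - mu * P vv) * yp = 0.
  have -> : P V - mu * P vv = \sum_i (P (xi 0 i) - mu * P (v 0 i)) * P (dot v (delta_mx 0 i)).
    rewrite (codotC gamP xi v) (codot_sum_delta v xi) (codot_sum_delta v v).
    rewrite !raddf_sum mulr_sumr /=.
    by rewrite -sumrB; apply: eq_bigr => i _; ring.
  rewrite /al mulr_sumr mulr_suml -big_split /= big1 // => i _.
  have := em i; rewrite -/q => emi.
  transitivity (P (dot v (delta_mx 0 i)) * ((P V - mu) * P q * yv 0 i +
     (P (xi 0 i) - mu * P (v 0 i)) * yp)); first by ring.
  by rewrite emi mulr0.
have qE : P q = P rho * P (h p rho) * P w ^+ 2 by rewrite /q; ring.
rewrite -/q !qE in eE f1 f2.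
have vvE : P vv = 1 - (P w ^+ 2)^-1.
  by rewrite -rmorphXn -fmorphV (lorentz_sqr gamP vv1) invrK; ring.
have hrE : P (drho h p rho) = P c ^+ 2 * P (h p rho) * ((P rho)^-1 - P (dp h p rho)).
  by rewrite (drho_enthalpyE eP p0 r0) -fmorphV; ring.
have [|||||y00 yp0] := characteristic_algebra _ _ _ _ _ vvE hrE X0 eD eE f1 f2 Qmu.
- exact/PN/lt0r_neq0.
- exact/PN/lt0r_neq0.
- exact/PN/lt0r_neq0.
- by rewrite expf_neq0 // PN // lt0r_neq0.
- by rewrite -fmorphV -rmorphB PN // lt_eqF // dp_enthalpy_gtVrho.
have yv0 : yv = 0.
  apply/rowP => i; rewrite [RHS]mxE; apply: (mulfI (mulf_neq0 X0 qN)).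
  by have := em i; rewrite yp0 !mulr0 addr0.
by rewrite y00 yp0 yv0 !raddf0 !row_mx0.
Qed.

Lemma real_complex_norm x : complex.ComplexField.Normc.normc (P x) = `|x|.
Proof. by rewrite /= expr0n addr0 sqrtr_sqr. Qed.

(** Multiplied by [1 - vv c^2], the quadratic factors over the reals, because a quarter of its
    discriminant is the square of the real number [s]. Hence its complex roots are real and
    [acoustic_root_bound] applies. *)
Lemma characteristic_root (mu : C) :
  (1 - P vv * P c ^+ 2) * mu ^+ 2 - 2 * P V * (1 - P c ^+ 2) * mu
    + (1 - P c ^+ 2) * P V ^+ 2 - P c ^+ 2 * (1 - P vv) * P zz = 0 ->
  exists2 x : R, mu = P x & `|x| <= acoustic c vv V zz.
Proof.
move=> Qmu.
have [c0 c1] := sound_speed_sqr_bounds eP p0 r0.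
have z0 := codot_ge0 gamP xi.
have CS := codot_CauchySchwarz gamP xi v; rewrite mulrC in CS.
have [B1 B2] := acoustic_root_bound V zz c0 c1 vv1.
set s := c * _ * _ in B1 B2.
have k0 : 0 < 1 - vv * c ^+ 2.
  have : vv * c ^+ 2 <= c ^+ 2 by rewrite ler_piMl ?sqr_ge0 // ltW.
  lra.
have s2 := acoustic_sqrt_sqr c0 c1 vv1 z0 CS; rewrite -/s in s2.
have kN : P (1 - vv * c ^+ 2) != 0 by rewrite fmorph_eq0 lt0r_neq0.
have : (P (1 - vv * c ^+ 2) * mu - P (V * (1 - c ^+ 2) + s))
    * (P (1 - vv * c ^+ 2) * mu - P (V * (1 - c ^+ 2) - s)) = 0.
  have s2' : P s ^+ 2 = P c ^+ 2 * (1 - P vv) *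
      ((1 - P vv * P c ^+ 2) * P zz - (1 - P c ^+ 2) * P V ^+ 2).
    by rewrite -rmorphXn s2; ring.
  transitivity (P (1 - vv * c ^+ 2) * ((1 - P vv * P c ^+ 2) * mu ^+ 2
      - 2 * P V * (1 - P c ^+ 2) * mu
      + (1 - P c ^+ 2) * P V ^+ 2 - P c ^+ 2 * (1 - P vv) * P zz)
      + (P c ^+ 2 * (1 - P vv) *
      ((1 - P vv * P c ^+ 2) * P zz - (1 - P c ^+ 2) * P V ^+ 2) - P s ^+ 2)).
    ring.
  by rewrite Qmu s2' subrr mulr0 addr0.
have root x : P (1 - vv * c ^+ 2) * mu - P x = 0 -> mu = P (x / (1 - vv * c ^+ 2)).
  by move/eqP; rewrite subr_eq0 => /eqP E; apply: (mulfI kN);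
    rewrite E -rmorphM mulrC mulfVK ?lt0r_neq0.
have norm_div x : `|x / (1 - vv * c ^+ 2)| = `|x| / (1 - vv * c ^+ 2).
  by rewrite normrM normfV (gtr0_norm k0).
move/eqP; rewrite mulf_eq0 => /orP[] /eqP /root muE.
  by exists ((V * (1 - c ^+ 2) + s) / (1 - vv * c ^+ 2)); rewrite ?norm_div.
by exists ((V * (1 - c ^+ 2) - s) / (1 - vv * c ^+ 2)); rewrite ?norm_div.
Qed.

Lemma jacobian_eigenvalue (alpha : R) (beta : 'rV[R]_3) (z : C) :
  let F := dir_flux e alpha beta gam xi in
  differentiable F U -> eigenvalue (map_mx P (jacobian F U)) z ->
  exists2 x : R, z = P x & `|x + pairing xi beta / alpha| <= acoustic c vv V zz.
Proof.
move=> F Fd; rewrite /eigenvalue /eigenspace.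
set J := jacobian F U; set b := _ / alpha => ev.
have MUJ : MU *m J = MG - b *: MU := tangent_mx_jacobian gamP eP WP Fd.
pose mu := z + P b.
have NE : map_mx P MG - mu *: map_mx P MU = map_mx P MU *m (map_mx P J - z%:M).
  rewrite mulmxBr -map_mxM MUJ mul_mx_scalar map_mxB map_mxZ /mu scalerDl.
  by rewrite opprD addrA addrAC.
have /rowV0Pn[Y /sub_kermxP YN Y0] : kermx (map_mx P MG - mu *: map_mx P MU) != 0.
  by rewrite NE; exact: kermx_mull_neq0.
suff [x muE xle] : exists2 x : R, mu = P x & `|x| <= acoustic c vv V zz.
  exists (x - b); last by rewrite subrK.
  by rewrite -[z](addrK (P b)) -/mu muE -rmorphB.
have [c0 c1] := sound_speed_sqr_bounds eP p0 r0.
have z0 := codot_ge0 gamP xi.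
have CS := codot_CauchySchwarz gamP xi v; rewrite mulrC in CS.
have [->|muV] := eqVneq mu (P V).
  by exists V => //; exact: acoustic_bound.
apply: characteristic_root; apply/eqP; apply: contraNT Y0 => Qmu.
by apply/eqP; exact: tangent_kernel_trivial YN.
Qed.

Lemma spectral_radius_acoustic (alpha : R) (beta : 'rV[R]_3) : 0 < alpha ->
  spectral_radius (jacobian (dir_flux e alpha beta gam xi) U) <=
  acoustic c vv V zz + `|pairing xi beta| / alpha.
Proof.
move=> a0.
have [c0 c1] := sound_speed_sqr_bounds eP p0 r0.
have z0 := codot_ge0 gamP xi.
have CS := codot_CauchySchwarz gamP xi v; rewrite mulrC in CS.
have S0 : 0 <= acoustic c vv V zz.
  by apply: le_trans (acoustic_bound c0 c1 vv1 z0 CS); exact: normr_ge0.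
have bE : `|pairing xi beta| / alpha = `|pairing xi beta / alpha|.
  by rewrite normrM normfV (gtr0_norm a0).
have r0' : 0 <= acoustic c vv V zz + `|pairing xi beta| / alpha.
  by rewrite addr_ge0 // bE.
rewrite /spectral_radius; set A := [set _ | _ in _].
(* On an empty set [sup] takes the default value [0]. *)
have [->|A0] := eqVneq A set0; first by rewrite sup0.
apply: ge_sup; first by apply/set0P.
move=> _ [z ev <-].
have [Fd|nFd] := pselect (differentiable (dir_flux e alpha beta gam xi) U).
  have [x -> xle] := jacobian_eigenvalue Fd ev.
  rewrite real_complex_norm bE -[x](addrK (pairing xi beta / alpha)).
  by apply: le_trans (ler_normB _ _) _; rewrite lerD2r.
move: ev; rewrite /= jacobian_ndiff // => /eigenvalueP[u].
have -> : map_mx (fun x : R => Complex x 0) 0 = 0 :> 'M[C]_(1 + (3 + 1)).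
  by apply/matrixP => i j; rewrite !mxE.
rewrite mulmx0 => /esym/eqP; rewrite scaler_eq0 => /orP[/eqP -> _|/eqP ->].
  by rewrite (real_complex_norm 0) normr0.
by rewrite eqxx.
Qed.

End SpectralRadius.

(** * Lax-Friedrichs splitting *)

Section LaxFriedrichs.
Variables (R : realType) (e : R -> R -> R) (gam : 'M[R]_3).
Hypotheses (gamP : is_metric gam) (eP : is_eos e).
Local Notation dot := (codot gam).
Variables (alpha : R) (beta : 'rV[R]_3) (rho p : R) (v xi : 'rV[R]_3).
Hypotheses (a0 : 0 < alpha) (WP : is_prim gam (rho, v, p)).
Local Notation U := (conservative e gam (rho, v, p)).
Local Notation G := (relative_flux e gam (rho, v, p) xi).
Local Notation S0 :=
  (acoustic (sound_speed e p rho) (dot v v) (dot xi v) (dot xi xi)).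

(** Common to both speed bounds: [S0 <= S] controls the spectral radius, the estimate for [G] gives
    the strict splitting through [relative_splitting], and letting [eta] decrease to the bound gives
    the closed one. *)
Lemma LF_splitting_of_core (S : R) : 0 < S -> S0 <= S ->
  (forall t, `|t| * S < 1 -> admissible gam (U + t *: G)) ->
  LF_splitting e alpha beta gam xi U (S + `|pairing xi beta| / alpha).
Proof.
move=> Sp S0S core; have bE : `|pairing xi beta| / alpha = `|pairing xi beta / alpha|.
  by rewrite normrM normfV (gtr0_norm a0).
have rp : 0 < S + `|pairing xi beta| / alpha by rewrite bE ltr_pwDl.
have strict eta : S + `|pairing xi beta| / alpha < eta ->
    admissible gam (U + eta^-1 *: dir_flux e alpha beta gam xi U) /\
    admissible gam (U - eta^-1 *: dir_flux e alpha beta gam xi U).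
  by rewrite dir_flux_conservative // bE; exact: relative_splitting.
split => //.
- apply: le_trans (spectral_radius_acoustic gamP eP xi WP beta a0) _.
  by rewrite lerD2r.
- by apply: closure_inv_scale => // eta /strict[].
- rewrite -scalerN; apply: closure_inv_scale => // eta /strict[_].
  by rewrite scalerN.
Qed.

Hypothesis xi0 : xi != 0.

Lemma acoustic_flux_bounds : 0 < S0 /\ S0 < Num.sqrt (dot xi xi).
Proof.
have [r0 p0] := WP; rewrite speed_lt1 // => v1.
have [c0 c1] := sound_speed_sqr_bounds eP p0 r0.
have z0 := codot_gt0 gamP xi0.
have CS := codot_CauchySchwarz gamP xi v; rewrite mulrC in CS.
by split; [exact: acoustic_gt0 (ltW z0) CS z0|exact: acoustic_lt (ltW z0) CS z0].
Qed.

Lemma LF_splitting_general :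
  LF_splitting e alpha beta gam xi U (rho_general alpha beta gam xi).
Proof.
have [S0p S0lt] := acoustic_flux_bounds.
apply: LF_splitting_of_core; [exact: lt_trans S0lt|exact: ltW|move=> t tS].
rewrite -relative_fluxZ //; apply: admissible_flux_general => //.
rewrite codotZl // codotZr // mulrA -expr2.
have := tS; rewrite -ltr_sqr ?nnegrE ?mulr_ge0 ?sqrtr_ge0 //.
by rewrite exprMn real_normK ?num_real // sqr_sqrtr ?codot_ge0 // expr1n.
Qed.

Lemma LF_splitting_ideal Gam : 1 < Gam -> Gam <= 2 -> is_ideal_eos Gam e ->
  LF_splitting e alpha beta gam xi U (rho_ideal e alpha beta gam xi U).
Proof.
move=> G1 G2 iP; have [S0p _] := acoustic_flux_bounds.
rewrite rho_idealE //; apply: LF_splitting_of_core => // t tS.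
rewrite -relative_fluxZ //; apply: (admissible_flux_ideal gamP eP WP G1) => //.
by rewrite !codotZl // codotZr // mulrA -expr2 acoustic_homogeneous.
Qed.

End LaxFriedrichs.

Theorem lemma3 (R : realType) (alpha : R) (beta : 'rV[R]_3) (gam : 'M[R]_3)
    (e : R -> R -> R) (U : state R)
    (alpha_gt0 : 0 < alpha) (gamP : is_metric gam) (eP : is_eos e)
    (UP : admissible gam U) :
  (forall lambda : R, 0 < lambda -> admissible gam (lambda *: U)) /\
  (forall xi : 'rV[R]_3, xi != 0 ->
     LF_splitting e alpha beta gam xi U (rho_general alpha beta gam xi) /\
     (forall Gam : R, 1 < Gam -> Gam <= 2 -> is_ideal_eos Gam e ->
        rho_ideal e alpha beta gam xi U < rho_general alpha beta gam xi /\
        LF_splitting e alpha beta gam xi U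
          (rho_ideal e alpha beta gam xi U))).
Proof.
split=> [lambda l0|xi xi0]; first exact: admissible_scale.
have [[[rho v] p] WP <-] := conservative_surj gamP eP UP.
split=> [|Gam G1 G2 iP]; first exact: LF_splitting_general.
split; last exact: LF_splitting_ideal G1 G2 iP.
by rewrite rho_idealE // ltrD2r; case: (acoustic_flux_bounds gamP eP WP xi0).
Qed.
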